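(* Let $(\chi_n)_{n\ge 2}$ be a sequence of positive reals with $\chi_n\to\infty$ as $n\to\infty$, put $\rho_n=\chi_n\log n$, and assume $0<\rho_n<n$ for every $n\ge 2$. Fix $\kappa\in(0,1)$ and set $$\varepsilon_n=\frac{2}{\chi_n^{1/8}},\qquad \varepsilon'_n=\frac{1}{\sqrt{\rho_n}\,(1-\kappa)}.$$ For $\varepsilon,\varepsilon'>0$ define the complex domains $$D^{(1)}_{\varepsilon,\varepsilon'}=\{z\in\mathbb C:\ \varepsilon'<|z|<1-\varepsilon\},\qquad D^{(2)}_{\varepsilon,\varepsilon'}=\{z\in\mathbb C:\ 1+\varepsilon<|z|<1/\varepsilon'\},$$ and, for $i=1,2$, the event $$\Phi^{(i)}_{n}=\Big\{\text{there exists } v\in D^{(i)}_{\varepsilon_n,\varepsilon'_n}\text{ such that } \big(\tilde Z^{(n)}(v)\big)^{-1}=0\Big\}.$$ Then for $i=1$ and $i=2$, $$\sum_{n\ge 2} P_{n}\big(\Phi^{(i)}_{n}\big)<\infty .$$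
   Context: For each $n$, let $\{a_{ij}: 1\le i<j\le n\}$ be jointly independent random variables on a probability space with law $P_n$, each equal to $1$ with probability $\rho_n/n$ and $0$ with probability $1-\rho_n/n$ (the Erdős–Rényi random graph $G(n,\rho_n/n)$). Let $A$ be the $n\times n$ symmetric adjacency matrix with $A_{ij}=a_{ij}$ for $i<j$, $A_{ij}=a_{ji}$ for $i>j$, $A_{ii}=0$; let $B$ be the diagonal matrix with $B_{ii}=\sum_{k=1}^n A_{ik}$ (vertex degrees); let $r=\frac12\sum_{i,j=1}^n A_{ij}-n+1$. The normalized (reciprocal) Ihara zeta function is defined for $v\in\mathbb C$ by $$\big(\tilde Z^{(n)}(v)\big)^{-1}=\Big(1-\frac{v^2}{\rho_n}\Big)^{r-1}\det\Big(I+\frac{v^2}{\rho_n}(B-I)-\frac{v}{\sqrt{\rho_n}}A\Big),$$ i.e. the right-hand side of Ihara's formula $(1-u^2)^{r-1}\det(I+u^2(B-I)-uA)$ evaluated at $u=v/\sqrt{\rho_n}$ (used as the definition even if the graph is disconnected). *)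

(* Defs.v *)
From HB Require Import structures.
From mathcomp Require Import all_boot all_order all_algebra.
From mathcomp Require Import all_classical all_reals all_analysis.
From mathcomp Require Import complex.
Set Implicit Arguments. Unset Strict Implicit. Unset Printing Implicit Defensive.
Import Order.TTheory GRing.Theory Num.Theory.
Local Open Scope ring_scope.

Definition edge_t (n : nat) := {p : 'I_n * 'I_n | (p.1 < p.2)%N}.

Definition config (n : nat) := {ffun edge_t n -> bool}.

Definition adjb (n : nat) (w : config n) (i j : 'I_n) : bool :=
  [exists e : edge_t n, ((val e == (i, j)) || (val e == (j, i))) && w e].

Section Zeta.
Variable R : realType.
Local Notation C := (R[i]).

Definition adjmx (n : nat) (w : config n) : 'M[C]_n :=
  \matrix_(i, j) ((adjb w i j)%:R : C).

Definition degmx (n : nat) (w : config n) : 'M[C]_n :=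
  \matrix_(i, j) ((i == j)%:R * \sum_(k < n) adjmx w i k).

(* r = (1/2) sum_{i,j} A_ij - n + 1 = #edges - n + 1 *)
Definition rank_r (n : nat) (w : config n) : int :=
  (#|[set e | w e]|%:Z - n%:Z + 1)%R.

(* normalized reciprocal Ihara zeta function (tilde Z^(n)(v))^{-1} *)
Definition zeta_inv (n : nat) (rho : R) (w : config n) (v : C) : C :=
  let u := v / (Num.sqrt rho)%:C%C in
  (1 - u ^+ 2) ^ (rank_r w - 1) *
  \det (1%:M + (u ^+ 2) *: (degmx w - 1%:M) - u *: adjmx w).

Definition config_weight (n : nat) (p : R) (w : config n) : R :=
  \prod_(e : edge_t n) (if w e then p else 1 - p).

Definition ER_prob (n : nat) (rho : R) (E : config n -> Prop) : R :=
  \sum_(w : config n) (if `[< E w >] then config_weight (rho / n%:R) w else 0).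

Definition dom1 (eps eps' : R) (z : C) : Prop :=
  eps'%:C%C < `|z| /\ `|z| < (1 - eps)%:C%C.
Definition dom2 (eps eps' : R) (z : C) : Prop :=
  (1 + eps)%:C%C < `|z| /\ `|z| < (1 / eps')%:C%C.

Definition Phi (D : R -> R -> C -> Prop) (n : nat) (rho eps eps' : R)
  (w : config n) : Prop :=
  exists v : C, D eps eps' v /\ zeta_inv rho w v = 0.

End Zeta.
Arguments ER_prob {R} n rho E.
Arguments Phi {R} D n rho eps eps' w.

(* Main.v *)
(* Put X = A - E A. A zero v of the reciprocal zeta function in one of the domains gives a
   kernel vector x of I + u^2 (B - I) - u A with u = v / sqrt rho. If u is not real, pairing
   with x gives a real quadratic equation with non-real root u, whence |u|^2 <x, (B - I) x> =
   |x|^2, and |v| is close to 1 once all degrees are close to rho (Chernoff). If u is real, x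
   can be taken real; |X| <= (2 + o(1)) sqrt rho makes the quadratic form positive at x, except
   possibly for positive u along the constant vector, and there the identity
   <1, (I + u^2 (B - I) - u A) x> = 0 (u = 1 is a trivial zero, with kernel vector 1) forces
   the sum of the entries of x to be small.

   The sharp norm bound comes from E tr X^K with K a power of two of order eps^-2 ln n.
   This is a sum over walks in which every edge is crossed 0 or at least 2 times. Giving each
   edge a state that records how often it must still be crossed, one shows by induction on
   the number of remaining steps that the sum over completions of a partial walk is at most
   c^L rho^(-d/2) phi(d_v + 1) prod_(u <> v) phi(d_u), where v is the current vertex, d_u is
   the number of pending crossings at u, d their total, and phi(m) = (m-1)!!. A step to a
   fresh vertex and a step along an open edge each contribute sqrt rho to c, all other
   steps contribute lower order terms, so c = (2 + o(1)) sqrt rho. *)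
Require Import Defs.
From HB Require Import structures.
From mathcomp Require Import all_boot all_order all_algebra.
From mathcomp Require Import all_classical all_reals all_analysis.
From mathcomp Require Import complex ring lra zify.
Import Order.TTheory GRing.Theory Num.Theory.
Local Open Scope classical_set_scope.
Local Open Scope ring_scope.
Set Implicit Arguments. Unset Strict Implicit. Unset Printing Implicit Defensive.

(** * Edge states along a walk *)

(** The double factorial (m-1)!!, equal to 1 at 0 and at 1. *)
Fixpoint dfact (m : nat) : nat :=
  if m is m'.+1 then (if m' is m''.+1 then (m' * dfact m'')%N else 1%N) else 1%N.

Arguments dfact : simpl never.

Lemma dfactSS (m : nat) : dfact m.+2 = (m.+1 * dfact m)%N.
Proof. by []. Qed.

Lemma dfact_gt0 (m : nat) : (0 < dfact m)%N.
Proof.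
suff: (0 < dfact m)%N && (0 < dfact m.+1)%N by case/andP.
elim: m => [//|m /andP[h1 h2]]; by rewrite h2 dfactSS muln_gt0 h1.
Qed.

Lemma dfact_sqr (m : nat) : (dfact m.+1 ^ 2 <= 2 * m.+1 * dfact m ^ 2)%N.
Proof.
(* The sharper factor [k.+1] closes an induction in steps of two, which reduces to (k+1)(k+3) <=
   (k+2)^2. The case [m = 0] is computed separately. *)
have key k : (dfact k.+2 ^ 2 <= 2 * k.+1 * dfact k.+1 ^ 2)%N.
  suff: (dfact k.+2 ^ 2 <= 2 * k.+1 * dfact k.+1 ^ 2)%N &&
        (dfact k.+3 ^ 2 <= 2 * k.+2 * dfact k.+2 ^ 2)%N by case/andP.
  elim: k => [//|k /andP[h1 h2]]; rewrite h2 andTb.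
  rewrite [dfact k.+4]dfactSS [dfact k.+3]dfactSS 2!expnMn.
  have h : (k.+3 ^ 2 * dfact k.+2 ^ 2 <= k.+3 ^ 2 * (2 * k.+1 * dfact k.+1 ^ 2))%N.
    by rewrite leq_mul2l h1 orbT.
  apply: leq_trans h _.
  rewrite !mulnA leq_mul2r; apply/orP; right; nia.
case: m => [//|m]; apply: leq_trans (key m) _.
by rewrite leq_mul2r leq_mul2l leqnSn !orbT.
Qed.

(* [Open1] ([Open2]) edges have been crossed but must still be crossed at least once (twice)
   more, since a centered entry has zero mean; a [Closed] edge has no obligation left. *)
Inductive edge_state := Fresh | Closed | Open1 | Open2.

Definition need (x : edge_state) : nat :=
  match x with Fresh | Closed => 0 | Open1 => 1 | Open2 => 2 end.

Definition is_fresh (x : edge_state) : bool := if x is Fresh then true else false.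

Definition upd {n : nat} {T : Type} (s : edge_t n -> T) (e : edge_t n) (x : T) :
  edge_t n -> T := fun f => if f == e then x else s f.

Lemma upd_same {n T} (s : edge_t n -> T) e x : upd s e x e = x.
Proof. by rewrite /upd eqxx. Qed.

Lemma upd_other {n T} (s : edge_t n -> T) e x f : f != e -> upd s e x f = s f.
Proof. by rewrite /upd => /negbTE->. Qed.

Lemma upd_upd {n T} (s : edge_t n -> T) e x y : upd (upd s e x) e y = upd s e y.
Proof. by apply/funext => f; rewrite /upd; case: eqP. Qed.

Lemma upd_comm {n T} (s : edge_t n -> T) e f x y : f != e ->
  upd (upd s e x) f y = upd (upd s f y) e x.
Proof.
by move=> fe; apply/funext => g; rewrite /upd; case: eqP => // ->; rewrite (negbTE fe).
Qed.

Definition incident {n : nat} (e : edge_t n) (v : 'I_n) : bool :=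
  ((val e).1 == v) || ((val e).2 == v).

Definition other {n : nat} (e : edge_t n) (v : 'I_n) : 'I_n :=
  if (val e).1 == v then (val e).2 else (val e).1.

Section Edges.
Variable n : nat.
Implicit Types (e f : edge_t n) (u v : 'I_n).

Lemma ends_neq e : (val e).1 != (val e).2.
Proof. by case: e => -[a b] /= ab; apply: contraTneq ab => ->; rewrite ltnn. Qed.

Lemma other_neq e v : incident e v -> other e v != v.
Proof.
rewrite /incident /other; have := ends_neq e.
by case: (eqVneq (val e).1 v) => [-> |ne] h /=; [rewrite eq_sym | move/eqP => <-].
Qed.

Lemma incident_other e v u : incident e v -> incident e u = (u == v) || (u == other e v).
Proof.
rewrite /incident /other; have := ends_neq e.
case: (eqVneq (val e).1 v) => [->|ne] h /=; first by rewrite !(eq_sym u).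
by move=> /eqP <-; rewrite !(eq_sym u) orbC.
Qed.

Lemma other_inj e f v : incident e v -> incident f v -> other e v = other f v -> e = f.
Proof.
case: e f => -[a b] /= ab [[c d] /= cd]; rewrite /incident /other /= => h1 h2 h.
apply: val_inj => /=; move: h1 h2 h.
have [av|av] := eqVneq a v; have [cv|cv] := eqVneq c v => //=.
- by move=> _ _ ->; rewrite av cv.
- by move=> _ /eqP dv bc; subst; lia.
- by move=> /eqP bv _ ad; subst; lia.
- by move=> /eqP -> /eqP -> ->.
Qed.

(** The graph is simple, so distinct edges at [v] have distinct far ends and no vertex is counted
    twice. *)
Lemma sum_other_le (f : 'I_n -> nat) v (P : pred (edge_t n)) :
  (\sum_(e | incident e v && P e) f (other e v) <= \sum_u f u)%N.
Proof.
set S := [set e | incident e v && P e]%SET.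
have inj : {in S &, injective (fun e => other e v)}.
  by move=> e g; rewrite !inE => /andP[h1 _] /andP[h2 _]; apply: other_inj.
have -> : (\sum_(e | incident e v && P e) f (other e v) = \sum_(e in S) f (other e v))%N.
  by apply: eq_bigl => e; rewrite inE.
rewrite -(big_imset (fun u => f u)) //=.
by rewrite [leqRHS](bigID (mem [set other e v | e in S]%SET)) /= leq_addr.
Qed.

(** Pending crossings at a vertex, pending crossings in all, and the number of edges touched so far.
    Each step touches at most one new edge, so the walk length controls the last and thereby the
    other two. *)
Definition deficit (s : edge_t n -> edge_state) v : nat :=
  \sum_(e | incident e v) need (s e).
Definition total (s : edge_t n -> edge_state) : nat := \sum_e need (s e).
Definition used (s : edge_t n -> edge_state) : nat := \sum_e ~~ is_fresh (s e).

Lemma deficit_upd s e x v :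
  (deficit (upd s e x) v + incident e v * need (s e) =
   deficit s v + incident e v * need x)%N.
Proof.
rewrite /deficit; case: (boolP (incident e v)) => h.
  rewrite (bigD1 e) //= upd_same [in RHS](bigD1 e) //= !mul1n addnAC [RHS]addnAC.
  rewrite (addnC (need x)); congr addn.
  by apply: eq_bigr => f /andP[_ fe]; rewrite upd_other.
rewrite !mul0n !addn0; apply: eq_bigr => f fv; rewrite upd_other //.
by apply: contraNneq h => <-.
Qed.

Lemma total_upd s e x : (total (upd s e x) + need (s e) = total s + need x)%N.
Proof.
rewrite /total (bigD1 e) //= upd_same [in RHS](bigD1 e) //= addnAC [RHS]addnAC.
rewrite (addnC (need x)); congr addn.
by apply: eq_bigr => f fe; rewrite upd_other.
Qed.

Lemma used_upd s e x : (used (upd s e x) <= (used s).+1)%N.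
Proof.
rewrite /used (bigD1 e) //= upd_same [in leqRHS](bigD1 e) //=.
rewrite -add1n leq_add ?leq_b1 //.
rewrite (eq_bigr (fun f => nat_of_bool (~~ is_fresh (s f)))); first exact: leq_addl.
by move=> f fe; rewrite upd_other.
Qed.

Lemma need_le x : (need x <= 2 * ~~ is_fresh x)%N.
Proof. by case: x. Qed.

Lemma total_le s : (total s <= 2 * used s)%N.
Proof. by rewrite /total /used big_distrr leq_sum //= => e _; apply: need_le. Qed.

Lemma deficit_le s v : (deficit s v <= total s)%N.
Proof.
by rewrite /deficit /total [leqRHS](bigID (fun e => incident e v)) /= leq_addr.
Qed.

Lemma sum_deficit s : (\sum_v deficit s v = 2 * total s)%N.
Proof.
rewrite /deficit /total (exchange_big_dep predT) //= big_distrr /=.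
apply: eq_bigr => e _; rewrite sum_nat_const; congr muln.
rewrite (eq_card (B := mem [set (val e).1; (val e).2]%SET)); last first.
  by move=> v; rewrite !inE unfold_in /incident !(eq_sym v).
by rewrite cards2 ends_neq.
Qed.

Lemma open_le s v : (\sum_(e | incident e v) (0 < need (s e)) <= deficit s v)%N.
Proof. by apply: leq_sum => e _; case: (s e). Qed.

End Edges.

(** * Sums over walks and their growth rate *)

Section WalkSums.
Variables (R : realFieldType) (n : nat).
Implicit Types (e f : edge_t n) (u v : 'I_n) (g : edge_t n -> nat -> R).

(** [g e r] is the weight of crossing [e] another [r] times. Each step shifts the weight of the edge
    it crosses, so the value is the sum over walks of length [L] from [v] of the product over [e] of
    [g e] at the number of crossings of [e]. *)
Fixpoint walk_sum (L : nat) v g : R :=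
  if L is L'.+1 then
    \sum_(e | incident e v) walk_sum L' (other e v) (upd g e (fun r => g e r.+1))
  else \prod_e g e 0%N.

Lemma walk_sum_le L v g g' :
  (forall e r, 0 <= g e r <= g' e r) -> walk_sum L v g <= walk_sum L v g'.
Proof.
elim: L v g g' => [|L IH] v g g' h /=.
  by apply: ler_prod => e _; exact: h.
apply: ler_sum => e _; apply: IH => f r; rewrite /upd; case: eqP => // _; exact: h.
Qed.

(** Each term of the expanded sum contains exactly one value of the weight of [e], hence depends
    linearly on that weight. *)
Lemma walk_sum_linear L v g e h1 h2 (a : R) :
  walk_sum L v (upd g e (fun r => a * (h1 r + h2 r))) =
  a * (walk_sum L v (upd g e h1) + walk_sum L v (upd g e h2)).
Proof.
elim: L v g h1 h2 => [|L IH] v g h1 h2 /=.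
  have E h : \prod_i upd g e h i 0%N = h 0%N * \prod_(i | i != e) g i 0%N.
    rewrite (bigD1 e) //= upd_same; congr (_ * _).
    by apply: eq_bigr => i ie; rewrite upd_other.
  by rewrite !E; ring.
rewrite -big_split /= big_distrr /=; apply: eq_bigr => f _.
have [->|fe] := eqVneq f e; first by rewrite !upd_same !upd_upd IH.
by rewrite !upd_other // !(upd_comm _ _ _ fe) IH.
Qed.

Variable p : R.
Hypothesis p_ge0 : 0 <= p.

(* Decomposes multiplicities: an edge crossed an even (odd >= 3) number of times starts in
   [Open1] ([Open2]), and every later pair of crossings reopens and closes it. *)
Definition state_weight (x : edge_state) (r : nat) : R :=
  match x with
  | Fresh => if r is r'.+1 then (if r' is _.+1 then p else 0) else 1
  | Closed => (~~ odd r)%:R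
  | Open1 => (odd r)%:R
  | Open2 => (~~ odd r && (0 < r)%N)%:R
  end.

Lemma state_weightS_Fresh r :
  state_weight Fresh r.+1 = p * (state_weight Open1 r + state_weight Open2 r).
Proof. by case: r => [|r] /=; rewrite ?andbT; [|case: (odd r) => /=]; rewrite ?addr0 ?add0r ?mulr0 ?mulr1. Qed.

(* The double factorial [(m-1)!!]: [phi m.+2 = m.+1 * phi m] pays for the choice among the
   at most [m.+1] open edges at the current vertex. *)
Definition phi (m : nat) : R := (dfact m)%:R.

(* The current vertex counts one extra half-edge, so that opening an edge towards a fresh
   vertex and closing an edge both leave the total potential of the next states unchanged. *)
Definition potential v (s : edge_t n -> edge_state) : R :=
  phi (deficit s v).+1 * \prod_(u | u != v) phi (deficit s u).

Lemma phi_gt0 m : 0 < phi m.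
Proof. by rewrite ltr0n dfact_gt0. Qed.

Lemma phiSS m : phi m.+2 = m.+1%:R * phi m.
Proof. by rewrite /phi dfactSS natrM. Qed.

Lemma phi_ratio (q : R) m : 0 <= q -> (2 * m.+1)%:R <= q ^+ 2 -> phi m.+1 <= q * phi m.
Proof.
move=> q0 hq; have p0 := phi_gt0 m; have p1 := phi_gt0 m.+1.
suff: phi m.+1 ^+ 2 <= (q * phi m) ^+ 2.
  by rewrite ler_pXn2r // nnegrE ?mulr_ge0 // ltW.
rewrite exprMn; apply: (@le_trans _ _ ((2 * m.+1)%:R * phi m ^+ 2)).
  by rewrite /phi -!natrX -[leRHS]natrM ler_nat dfact_sqr.
by rewrite ler_wpM2r // sqr_ge0.
Qed.

Lemma potential_gt0 v s : 0 < potential v s.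
Proof. by rewrite mulr_gt0 ?phi_gt0 // prodr_gt0 // => u _; exact: phi_gt0. Qed.

(** Only the factors at the two ends of [e] change, and the extra half-edge moves from [v] to [o].
    Cross-multiplied to avoid division. *)
Lemma potential_upd v s e x : incident e v -> let o := other e v in
  let s' := upd s e x in
  potential o s' * (phi (deficit s v).+1 * phi (deficit s o)) =
  potential v s * (phi (deficit s' v) * phi (deficit s' o).+1).
Proof.
move=> ev o s'; have ov : o != v by exact: other_neq.
rewrite /potential (bigD1 v) 1?eq_sym //= (bigD1 o (P := fun u => u != v)) //=.
set P := \prod_(i | _) _; set P' := \prod_(i | _) _.
have -> : P = P'.
  apply: eq_big => [u|u /andP[h1 h2]]; first by rewrite andbC.
  have := deficit_upd s e x u.
  by rewrite (incident_other _ ev) (negbTE h1) (negbTE h2) !addn0 => ->.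
ring.
Qed.

Section Step.
Variables (v : 'I_n) (s : edge_t n -> edge_state) (e : edge_t n).
Hypothesis ev : incident e v.
Let o := other e v.

Let deficits x : (deficit (upd s e x) v + need (s e) = deficit s v + need x)%N /\
  (deficit (upd s e x) o + need (s e) = deficit s o + need x)%N.
Proof.
have h1 := deficit_upd s e x v; have h2 := deficit_upd s e x o.
by move: h1 h2; rewrite !(incident_other _ ev) !eqxx orbT !mul1n.
Qed.

(** At [v] the new pending crossing replaces the extra half-edge, so that factor is unchanged; at
    [o], of deficit f, it joins the extra half-edge and phi(f+2) = (f+1) phi(f). *)
Lemma potential_open : need (s e) = 0%N ->
  potential o (upd s e Open1) = potential v s * (deficit s o).+1%:R.
Proof.
move=> s0; have := potential_upd s Open1 ev => /=; rewrite -/o.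
have [] := deficits Open1; rewrite s0 /= !addn0 !addn1 => -> ->; rewrite phiSS => h.
have p1 := phi_gt0 (deficit s v).+1; have p2 := phi_gt0 (deficit s o).
apply: (mulIf (x := phi (deficit s v).+1 * phi (deficit s o))).
  by rewrite mulf_neq0 // gt_eqF.
by rewrite h; ring.
Qed.

Lemma potential_open2 (q : R) : 0 <= q -> need (s e) = 0%N ->
  (2 * (deficit s v).+2)%:R <= q ^+ 2 -> (2 * (deficit s o).+1)%:R <= q ^+ 2 ->
  potential o (upd s e Open2) <= potential v s * (q * (2 + 3 * (deficit s o)%:R * q)).
Proof.
move=> q0 s0 hv ho; have := potential_upd s Open2 ev => /=; rewrite -/o.
have [] := deficits Open2; rewrite s0 /= !addn0 !addn2 => -> ->; rewrite [phi _.+3]phiSS => h.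
set d := deficit s v in hv h *; set f := deficit s o in ho h *.
have p1 := phi_gt0 d.+1; have p2 := phi_gt0 f; have pv := potential_gt0 v s.
rewrite -(ler_pM2r (mulr_gt0 p1 p2)) h -[leRHS]mulrA ler_pM2l //.
have r1 := phi_ratio q0 hv; have r2 := phi_ratio q0 ho.
have -> : q * (2 + 3 * f%:R * q) * (phi d.+1 * phi f) =
   (q * phi d.+1) * ((2 + 3 * f%:R * q) * phi f) by ring.
apply: ler_pM => //; rewrite ?mulr_ge0 ?(ltW (phi_gt0 _)) //.
(* If [f] is 0, the ratio phi(3) / phi(0) is exactly 2; otherwise f + 2 <= 3 f pays for the factor
   q. Thus the term that will be summed over up to [n] edges carries only one power of q. *)
case: (f) r2 => [|k] r2; first by rewrite mulr0 mul0r addr0.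
apply: (@le_trans _ _ (k.+3%:R * (q * phi k.+1))); first by rewrite ler_wpM2l.
rewrite mulrA ler_wpM2r ?(ltW (phi_gt0 _)) //.
have k0 : 0 <= k%:R :> R by [].
have := mulr_ge0 k0 q0; rewrite -[k.+3]addn3 -[k.+1]addn1 !natrD; lra.
Qed.

(** At [v] the factor phi(d+1) = d phi(d-1) drops to phi(d-1); at the other end the extra half-edge
    replaces the crossing just made. The at most d open edges at [v] therefore share one
    [potential v s]. *)
Lemma potential_close x : need (s e) = (need x).+1 ->
  (deficit s v)%:R * potential o (upd s e x) = potential v s.
Proof.
move=> sx; have := potential_upd s x ev => /=; rewrite -/o.
have [] := deficits x; rewrite sx !addnS -!addSn => /addIn <- /addIn <-; rewrite phiSS => h.
have p1 := phi_gt0 (deficit (upd s e x) v); have p2 := phi_gt0 (deficit (upd s e x) o).+1.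
apply: (mulIf (x := phi (deficit (upd s e x) v) * phi (deficit (upd s e x) o).+1)).
  by rewrite mulf_neq0 // gt_eqF.
by rewrite -h; ring.
Qed.

End Step.

Lemma upd_state_weight (s : edge_t n -> edge_state) e x :
  upd (fun f => state_weight (s f)) e (state_weight x) =
  (fun f => state_weight (upd s e x f)).
Proof. by apply/funext => f; rewrite /upd; case: eqP. Qed.

(** An edge still open when the walk ends has weight zero, so only states without pending crossings
    survive, and their potential is 1. *)
Lemma prod_state_weight0 v s :
  \prod_e state_weight (s e) 0 <= (total s == 0%N)%:R * potential v s.
Proof.
have [/eqP t0|] := eqVneq (total s) 0%N.
  have d0 u : deficit s u = 0%N by apply/eqP; rewrite -leqn0 -(eqP t0) deficit_le.
  have -> : potential v s = 1.
    by rewrite /potential d0 big1 ?mulr1 // => u _; rewrite d0.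
  rewrite mulr1; apply: prodr_ile1 => e _.
  by case: (s e) => /=; rewrite ?lexx ?ler01.
move=> t0; have /existsP[e he] : [exists e, need (s e) != 0%N].
  apply: contraNT t0 => /existsPn h; rewrite /total big1 // => e _.
  by apply/eqP; have := h e; rewrite negbK.
rewrite mul0r (bigD1 e) //=.
by case: (s e) he => //= _; rewrite mul0r.
Qed.

Variables (K : nat) (q c tau : R).
Hypothesis tau_gt0 : 0 < tau.
Hypothesis q_ge0 : 0 <= q.
Hypothesis q_sqr : (4 * K + 4)%:R <= q ^+ 2.
(** In order: crossings of open edges, [Fresh] to [Open1], [Closed] to [Open1], [Fresh] to [Open2].
    At a vertex there are at most [n] fresh and [K] closed edges, and the deficits of its neighbours
    add up to at most 4 K. *)
Hypothesis c_large :
  tau^-1 + p * tau * (n%:R + 4 * K%:R) + tau * (5 * K%:R)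
  + p * tau ^+ 2 * q * (2 * n%:R + 12 * K%:R * q) <= c.

(* Factor by which crossing [e] multiplies [tau ^+ total s * potential v s]. *)
Let cost (s : edge_t n -> edge_state) v e : R :=
  let f := (deficit s (other e v))%:R in
  match s e with
  | Fresh => p * tau * (1 + f) + p * tau ^+ 2 * q * (2 + 3 * f * q)
  | Closed => tau * (1 + f)
  | _ => tau^-1 * (deficit s v)%:R^-1
  end.

Lemma sum_cost s v : (used s <= K)%N -> \sum_(e | incident e v) cost s v e <= c.
Proof.
move=> uK; apply: le_trans c_large.
have tK : (total s <= 2 * K)%N by apply: leq_trans (total_le s) _; rewrite leq_mul2l.
have tau0 := ltW tau_gt0.
pose f e := (deficit s (other e v))%:R : R.
have ff (P : pred (edge_t n)) : \sum_(e | incident e v && P e) f e <= 4 * K%:R.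
  rewrite -natr_sum -natrM ler_nat; apply: leq_trans (sum_other_le _ _ _) _.
  by rewrite sum_deficit; lia.
have cn (P : pred (edge_t n)) : \sum_(e | incident e v && P e) 1 <= n%:R :> R.
  have -> : \sum_(e | incident e v && P e) 1 = (\sum_(e | incident e v && P e) 1%N)%:R :> R.
    by rewrite natr_sum.
  rewrite ler_nat; apply: leq_trans (sum_other_le (fun=> 1%N) v P) _.
  by rewrite sum_nat_const card_ord muln1.
pose fr e := is_fresh (s e); pose op e := (0 < need (s e))%N.
have -> : \sum_(e | incident e v) cost s v e =
  \sum_(e | incident e v && fr e) (p * tau * (1 + f e) + p * tau ^+ 2 * q * (2 + 3 * f e * q))
  + \sum_(e | incident e v && (~~ fr e && ~~ op e)) tau * (1 + f e)
  + \sum_(e | incident e v && op e) tau^-1 * (deficit s v)%:R^-1.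
  rewrite !big_mkcondr -!big_split /=; apply: eq_bigr => e _.
  by rewrite /cost /f /fr /op; case: (s e) => /=; rewrite ?addr0 ?add0r.
have h1 : \sum_(e | incident e v && op e) tau^-1 * (deficit s v)%:R^-1 <= tau^-1.
  rewrite -big_distrr /= -[leRHS]mulr1 ler_wpM2l ?invr_ge0 //.
  (* With no pending crossing at [v] the convention 1/0 = 0 makes the sum vanish. *)
  have [d0|d0] := posnP (deficit s v).
    by rewrite d0 invr0 big1.
  have -> : \sum_(e | incident e v && op e) (deficit s v)%:R^-1 =
     (\sum_(e | incident e v && op e) 1%N)%:R / (deficit s v)%:R :> R.
    by rewrite natr_sum big_distrl /=; apply: eq_bigr => e _; rewrite mul1r.
  rewrite ler_pdivrMr ?ltr0n // mul1r ler_nat big_mkcondr /=.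
  apply: leq_trans (open_le s v); apply: leq_sum => e _.
  by rewrite /op; case: (need (s e)).
have h2 : \sum_(e | incident e v && (~~ fr e && ~~ op e)) tau * (1 + f e)
   <= tau * (5 * K%:R).
  rewrite -big_distrr /= ler_wpM2l // big_split /=.
  have -> : 5 * K%:R = K%:R + 4 * K%:R :> R by ring.
  apply: lerD; last exact: ff.
  have -> : \sum_(e | incident e v && (~~ fr e && ~~ op e)) 1 =
      (\sum_(e | incident e v && (~~ fr e && ~~ op e)) 1%N)%:R :> R by rewrite natr_sum.
  rewrite ler_nat; apply: leq_trans uK; rewrite /used big_mkcond /=.
  by apply: leq_sum => e _; rewrite /fr; case: (incident e v); case: (is_fresh (s e)); case: (op e).
have h3 : \sum_(e | incident e v && fr e)
     (p * tau * (1 + f e) + p * tau ^+ 2 * q * (2 + 3 * f e * q))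
   <= p * tau * (n%:R + 4 * K%:R) + p * tau ^+ 2 * q * (2 * n%:R + 12 * K%:R * q).
  rewrite big_split /=; apply: lerD.
    rewrite -big_distrr /=; apply: ler_wpM2l; first exact: mulr_ge0.
    by rewrite big_split /=; apply: lerD.
  rewrite -big_distrr /=; apply: ler_wpM2l; first by rewrite mulr_ge0 // mulr_ge0 // exprn_ge0.
  have -> : \sum_(e | incident e v && fr e) (2 + 3 * f e * q) =
      2 * (\sum_(e | incident e v && fr e) 1) + 3 * q * \sum_(e | incident e v && fr e) f e.
    by rewrite !big_distrr -big_split /=; apply: eq_bigr => e _; ring.
  have -> : 12 * K%:R * q = 3 * q * (4 * K%:R) by ring.
  by apply: lerD; rewrite ler_wpM2l // mulr_ge0.
lra.
Qed.

(** Each transition multiplies the bound by at most [cost s v e], and these factors add up to at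
    most [c]. The budget [used s + L <= K] survives every step, which keeps [sum_cost]
    applicable. *)
Lemma walk_sum_bound L v s : (used s + L <= K)%N ->
  walk_sum L v (fun e => state_weight (s e)) <= c ^+ L * tau ^+ total s * potential v s.
Proof.
elim: L v s => [|L IH] v s.
  move=> _; rewrite /= expr0 mul1r; apply: le_trans (prod_state_weight0 v s) _.
  rewrite ler_wpM2r ?(ltW (potential_gt0 _ _)) //.
  by case: eqVneq => [->|_]; rewrite ?expr0 // exprn_ge0 // ltW.
rewrite addnS => sK.
have uK : (used s <= K)%N by apply: leq_trans sK; rewrite leqW // leq_addr.
have tK : (total s <= 2 * K)%N by apply: leq_trans (total_le s) _; rewrite leq_mul2l.
have dK u : (deficit s u <= 2 * K)%N by apply: leq_trans (deficit_le s u) tK.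
have tau0 := ltW tau_gt0; have taun0 := lt0r_neq0 tau_gt0.
have c0 : 0 <= c.
  apply: le_trans c_large; rewrite !addr_ge0 ?invr_ge0 ?mulr_ge0 ?exprn_ge0 //.
  by rewrite addr_ge0 ?mulr_ge0.
have cL := exprn_ge0 L c0.
set B := c ^+ L * tau ^+ total s * potential v s.
have B0 : 0 <= B.
  apply: mulr_ge0; last exact: ltW (potential_gt0 v s).
  exact: mulr_ge0 cL (exprn_ge0 _ tau0).
have IHx e x : walk_sum L (other e v) (fun f => state_weight (upd s e x f)) <=
   c ^+ L * tau ^+ total (upd s e x) * potential (other e v) (upd s e x).
  by apply: IH; apply: leq_trans sK; rewrite -addSn leq_add2r used_upd.
have open1 e : incident e v -> need (s e) = 0%N ->
    walk_sum L (other e v) (fun f => state_weight (upd s e Open1 f)) <=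
    B * (tau * (1 + (deficit s (other e v))%:R)).
  move=> ev s0; apply: le_trans (IHx _ _) _; rewrite (potential_open ev s0).
  have := total_upd s e Open1; rewrite s0 addn0 addn1 => ->.
  by rewrite /B exprS -[_.+1]addn1 natrD le_eqVlt; apply/orP; left; apply/eqP; ring.
have open2 e : incident e v -> need (s e) = 0%N ->
    walk_sum L (other e v) (fun f => state_weight (upd s e Open2 f)) <=
    B * (tau ^+ 2 * q * (2 + 3 * (deficit s (other e v))%:R * q)).
  move=> ev s0; apply: le_trans (IHx _ _) _.
  have := total_upd s e Open2; rewrite s0 addn0 => ->; rewrite exprD.
  have hq m : (m <= 2 * K + 2)%N -> (2 * m)%:R <= q ^+ 2.
    by move=> h; apply: le_trans q_sqr; rewrite ler_nat; clear -h; lia.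
  have := @potential_open2 v s e ev q q_ge0 s0.
  move=> /(_ _ _)-/(_ (hq _ _) (hq _ _)) h.
  apply: (@le_trans _ _ (c ^+ L * (tau ^+ total s * tau ^+ need Open2) *
     (potential v s * (q * (2 + 3 * (deficit s (other e v))%:R * q))))).
    rewrite ler_wpM2l ?mulr_ge0 ?exprn_ge0 //; apply: h.
      by have := dK v; clear; lia.
    by have := dK (other e v); clear; lia.
  by rewrite /B le_eqVlt; apply/orP; left; apply/eqP; rewrite /=; ring.
have close e x : incident e v -> need (s e) = (need x).+1 ->
    walk_sum L (other e v) (fun f => state_weight (upd s e x f)) <=
    B * (tau^-1 * (deficit s v)%:R^-1).
  move=> ev sx; apply: le_trans (IHx _ _) _.
  have := total_upd s e x; rewrite sx addnS -addSn => /addIn tE.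
  have pE := potential_close ev sx.
  have d0 : (deficit s v)%:R != 0 :> R.
    rewrite pnatr_eq0 -lt0n; apply: leq_trans (open_le s v).
    by rewrite (bigD1 e) //= sx.
  rewrite /B -pE -tE exprS le_eqVlt; apply/orP; left; apply/eqP.
  by field; rewrite d0 taun0.
rewrite [leRHS](_ : _ = B * c); last by rewrite /B exprS; ring.
apply: (@le_trans _ _ (B * \sum_(e | incident e v) cost s v e)); last first.
  by rewrite ler_wpM2l // sum_cost.
rewrite big_distrr /=; apply: ler_sum => e ev.
(* Shifting the weight of the crossed edge yields the weight of its next state: [Fresh] splits into
   [Open1] and [Open2] with factor [p], [Closed] reopens as [Open1], [Open1] closes, [Open2] becomes
   [Open1]. *)
rewrite /cost; case E : (s e).
- rewrite (_ : (fun r => state_weight Fresh r.+1) = fun r => p * (state_weight Open1 r + state_weight Open2 r)).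
    rewrite walk_sum_linear !upd_state_weight.
    have h1 := open1 _ ev; have h2 := open2 _ ev; rewrite E in h1 h2.
    have := ler_wpM2l p_ge0 (lerD (h1 erefl) (h2 erefl)); move/le_trans; apply.
    by rewrite le_eqVlt; apply/orP; left; apply/eqP; ring.
  by apply/funext => r; exact: state_weightS_Fresh.
- rewrite (_ : (fun r => state_weight Closed r.+1) = state_weight Open1); last first.
    by apply/funext => r; rewrite /= negbK.
  by rewrite upd_state_weight; apply: open1 => //; rewrite E.
- rewrite (_ : (fun r => state_weight Open1 r.+1) = state_weight Closed); last by [].
  by rewrite upd_state_weight; apply: close => //; rewrite E.
- rewrite (_ : (fun r => state_weight Open2 r.+1) = state_weight Open1); last first.
    by apply/funext => r; rewrite /= negbK andbT.
  by rewrite upd_state_weight; apply: close => //; rewrite E.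
Qed.

End WalkSums.

(** * Moments of the centered adjacency matrix *)

Section Expectation.
Variables (R : realType) (n : nat) (p : R).
Hypothesis p01 : 0 <= p <= 1.
Implicit Types (w : config n) (i j v : 'I_n) (e f : edge_t n).

Definition expect (F : config n -> R) : R := \sum_w config_weight p w * F w.

Let bias (b : bool) : R := if b then p else 1 - p.

Lemma expect_prod (G : edge_t n -> bool -> R) :
  expect (fun w => \prod_e G e (w e)) = \prod_e \sum_b bias b * G e b.
Proof.
rewrite bigA_distr_bigA; apply: eq_bigr => w _.
by rewrite /config_weight -big_split.
Qed.

Lemma config_weight_ge0 w : 0 <= config_weight p w.
Proof.
by apply: prodr_ge0 => e _; case: ifP => _; move: p01 => /andP[? ?] //; rewrite subr_ge0.
Qed.

Lemma expect_sum (I : finType) (P : pred I) (F : I -> config n -> R) :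
  expect (fun w => \sum_(i | P i) F i w) = \sum_(i | P i) expect (F i).
Proof.
by rewrite /expect exchange_big /=; apply: eq_bigr => w _; rewrite big_distrr.
Qed.

Definition centered w : 'M[R]_n :=
  \matrix_(i, j) (if i == j then 0 else (adjb w i j)%:R - p).

Lemma edge_exists i j : i != j -> exists e : edge_t n, incident e i /\ other e i = j.
Proof.
rewrite neq_ltn => /orP[ij|ij].
  by exists (exist _ (i, j) ij); rewrite /incident /other /= eqxx.
exists (exist _ (j, i) ij); rewrite /incident /other /= eqxx orbT; split => //.
by case: eqVneq ij => // ->.
Qed.

Lemma adjb_other w e i : incident e i -> adjb w i (other e i) = w e.
Proof.
move=> ei; apply/existsP/idP => [[f /andP[h wf]]|we].
  suff -> : e = f by [].
  have [fi fo] : incident f i /\ other f i = other e i.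
    move: (ends_neq f); case/orP: h => /eqP h; rewrite /incident /other h /= ?eqxx ?orbT //.
    by move=> /negbTE ->.
  exact: (other_inj ei fi).
exists e; rewrite we andbT; move: ei; rewrite /incident /other.
case: (val e) => a b /=; case: (eqVneq a i) => [->|_] /=; first by rewrite eqxx.
by move/eqP => ->; rewrite eqxx orbT.
Qed.

Lemma sum_centered w v (F : 'I_n -> R) :
  \sum_j centered w v j * F j = \sum_(e | incident e v) ((w e)%:R - p) * F (other e v).
Proof.
pose S := [set e | incident e v]%SET.
have inj : {in S &, injective (fun e => other e v)}.
  by move=> e g; rewrite !inE => h1 h2; apply: other_inj.
have im : [set other e v | e in S]%SET = [set j | j != v]%SET.
  apply/setP => j; rewrite inE; apply/imsetP/idP => [[e]|jv].
    by rewrite inE => ev ->; exact: other_neq.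
  by have [|e [ev eo]] := @edge_exists v j; [rewrite eq_sym|exists e; rewrite ?inE].
rewrite (bigD1 v) //= mxE eqxx mul0r add0r.
rewrite (eq_bigl (mem [set other e v | e in S]%SET)); last by move=> j; rewrite im !inE.
rewrite big_imset //=; apply: eq_big => [e|e]; first by rewrite inE.
rewrite inE => ev; by rewrite mxE eq_sym (negbTE (other_neq ev)) adjb_other.
Qed.

(** Expanding the power row by row produces a walk whose entries are collected in [G]; hence the
    generality in [G]. At the end the expectation factors over the independent edges. *)
Lemma expect_walk L v i (G : edge_t n -> bool -> R) :
  `|expect (fun w => \prod_e G e (w e) * (centered w ^+ L) v i)| <=
  walk_sum L v (fun e r => `|\sum_b bias b * (G e b * (b%:R - p) ^+ r)|).
Proof.
elim: L v G => [|L IH] v G /=.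
  have -> : expect (fun w => \prod_e G e (w e) * (centered w ^+ 0) v i) =
      expect (fun w => \prod_e G e (w e)) * (v == i)%:R.
    by rewrite /expect big_distrl; apply: eq_bigr => w _; rewrite expr0 mxE mulrA.
  rewrite expect_prod normrM normr_prod ger0_norm // -[leRHS]mulr1.
  apply: ler_pM => //; rewrite ?prodr_ge0 // ?lern1 ?leq_b1 //.
  by under [leRHS]eq_bigr => e _ do (under eq_bigr do rewrite expr0 mulr1).
have -> : expect (fun w => \prod_e G e (w e) * (centered w ^+ L.+1) v i) =
   \sum_(e | incident e v) expect (fun w =>
     \prod_f upd G e (fun b => G e b * (b%:R - p)) f (w f) * (centered w ^+ L) (other e v) i).
  rewrite -expect_sum; apply: eq_bigr => w _; congr (_ * _).
  rewrite exprS -[_ * centered w ^+ L]/(_ *m _) mxE sum_centered big_distrr /=.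
  apply: eq_bigr => e _; rewrite mulrA; congr (_ * _).
  rewrite (bigD1 e) //= [RHS](bigD1 e) //= upd_same mulrAC; congr (_ * _).
  by apply: eq_bigr => f fe; rewrite upd_other.
apply: le_trans (ler_norm_sum _ _ _) _; apply: ler_sum => e ev.
apply: le_trans (IH _ _) _; rewrite le_eqVlt; apply/orP; left; apply/eqP; congr walk_sum.
apply/funext => f; rewrite /upd; case: eqP => // _; apply/funext => r.
by congr `|_|; apply: eq_bigr => b _; rewrite exprS !mulrA.
Qed.

(** The first central moment vanishes, which kills edges crossed once; from the second on, p (1-p) +
    (1-p) p^2 = p - p^3 is a bound. *)
Lemma central_moment_le r :
  `|\sum_b bias b * (b%:R - p) ^+ r| <= state_weight p Fresh r.
Proof.
move: p01 => /andP[p0 p1]; have q0 : 0 <= 1 - p by rewrite subr_ge0.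
have -> : \sum_b bias b * (b%:R - p) ^+ r = p * (1 - p) ^+ r + (1 - p) * (- p) ^+ r.
  by rewrite big_bool /bias sub0r.
case: r => [|[|r]].
- by rewrite !expr0 !mulr1 addrC subrK normr1.
- by rewrite !expr1 (_ : p * (1 - p) + (1 - p) * - p = 0) ?normr0 //; ring.
rewrite -[leRHS]/p.
apply: le_trans (ler_normD _ _) _; rewrite (normrM p) (normrM (1 - p) ((- p) ^+ r.+2)) 2!normrX normrN !ger0_norm //.
have a1 : (1 - p) ^+ r.+2 <= (1 - p) ^+ 1 by rewrite ler_wiXn2l // gerBl.
have a2 : p ^+ r.+2 <= p ^+ 2 by rewrite ler_wiXn2l.
rewrite expr1 in a1; have := ler_wpM2l p0 a1; have := ler_wpM2l q0 a2.
have : 0 <= p * p * p by rewrite !mulr_ge0.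
by rewrite expr2; nra.
Qed.

(** All edges start [Fresh], where [total] is 0 and the potential is 1; the factor [n] counts the
    starting vertices. *)
Lemma expect_trace_le (K : nat) (q c tau : R) : 0 < tau -> 0 <= q ->
  (4 * K + 4)%:R <= q ^+ 2 ->
  tau^-1 + p * tau * (n%:R + 4 * K%:R) + tau * (5 * K%:R)
    + p * tau ^+ 2 * q * (2 * n%:R + 12 * K%:R * q) <= c ->
  expect (fun w => \tr (centered w ^+ K)) <= n%:R * c ^+ K.
Proof.
move=> tau0 q0 qK hc; move: (p01) => /andP[p0 p1].
rewrite /mxtrace expect_sum; apply: (@le_trans _ _ (\sum_(i < n) c ^+ K)); last first.
  by rewrite sumr_const card_ord mulr_natl.
apply: ler_sum => i _.
have := @expect_walk K i i (fun _ _ => 1).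
rewrite (_ : expect _ = expect (fun w => (centered w ^+ K) i i)); last first.
  by apply: eq_bigr => w _; rewrite big1 // mul1r.
move=> h; apply: le_trans (ler_norm _) (le_trans h _).
pose s : edge_t n -> edge_state := fun=> Fresh.
apply: (@le_trans _ _ (walk_sum K i (fun e => state_weight p (s e)))).
  apply: walk_sum_le => e r; rewrite normr_ge0 /=.
  by apply: le_trans (central_moment_le r); under eq_bigr do rewrite mul1r.
have t0 : total s = 0%N by rewrite /total big1.
have d0 u : deficit s u = 0%N by rewrite /deficit big1.
have u0 : used s = 0%N by rewrite /used big1.
have -> : c ^+ K = c ^+ K * tau ^+ total s * potential R i s.
  by rewrite t0 expr0 mulr1 /potential d0 big1 ?mulr1 // => u _; rewrite d0.
by apply: (walk_sum_bound p0 tau0 q0 qK hc); rewrite u0 add0n.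
Qed.

End Expectation.

(** * Norm bounds for symmetric matrices from traces *)

Section SymmetricMatrices.
Variables (R : realFieldType) (n : nat).
Implicit Types (x y : 'cV[R]_n) (Y : 'M[R]_n).

Definition dot x y : R := \sum_i x i 0 * y i 0.

Lemma dot_ge0 x : 0 <= dot x x.
Proof. by apply: sumr_ge0 => i _; rewrite -expr2 sqr_ge0. Qed.

Lemma dotC x y : dot x y = dot y x.
Proof. by apply: eq_bigr => i _; rewrite mulrC. Qed.

(** Lagrange's identity: twice the defect is a double sum of squares. *)
Lemma cauchy_schwarz_sum (a b : 'I_n -> R) :
  (\sum_i a i * b i) ^+ 2 <= (\sum_i a i * a i) * (\sum_i b i * b i).
Proof.
have : 0 <= \sum_i \sum_j (a i * b j - a j * b i) ^+ 2.
  by apply: sumr_ge0 => i _; apply: sumr_ge0 => j _; exact: sqr_ge0.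
have -> : \sum_i \sum_j (a i * b j - a j * b i) ^+ 2 =
  2 * ((\sum_i a i * a i) * (\sum_i b i * b i) - (\sum_i a i * b i) ^+ 2).
  have E1 (u v : 'I_n -> R) : (\sum_i u i) * (\sum_j v j) = \sum_i \sum_j u i * v j.
    by rewrite big_distrl; apply: eq_bigr => i _; rewrite big_distrr.
  rewrite expr2 mulr_natl mulr2n.
  rewrite {1}[(\sum_i a i * a i) * _]mulrC !E1 -!sumrB -big_split /=.
  by apply: eq_bigr => i _; rewrite -!sumrB -big_split /=; apply: eq_bigr => j _; ring.
by rewrite pmulr_rge0 // subr_ge0.
Qed.

Lemma dot_cauchy_schwarz x y : dot x y ^+ 2 <= dot x x * dot y y.
Proof. exact: cauchy_schwarz_sum. Qed.

Lemma dot_symm Y x y : Y^T = Y -> dot (Y *m x) y = dot x (Y *m y).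
Proof.
move=> YT; rewrite /dot.
under eq_bigr do rewrite mxE big_distrl /=.
under [RHS]eq_bigr do rewrite mxE big_distrr /=.
rewrite exchange_big /=; apply: eq_bigr => i _; apply: eq_bigr => j _.
by rewrite -[in Y j i]YT mxE; ring.
Qed.

(** For symmetric [Y] the trace of Y^2 is the squared Frobenius norm. *)
Lemma dot_frobenius Y x : Y^T = Y -> dot (Y *m x) (Y *m x) <= dot x x * \tr (Y ^+ 2).
Proof.
move=> YT; rewrite /mxtrace mulr_sumr; apply: ler_sum => i _.
rewrite mxE -expr2; apply: le_trans (cauchy_schwarz_sum _ _) _.
rewrite mulrC ler_wpM2l ?dot_ge0 // expr2 -[_ * _]/(Y *m Y) mxE.
have Ys j : Y j i = Y i j by rewrite -[in LHS]YT mxE.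
by apply: ler_sum => j _; rewrite Ys.
Qed.

(* Iterates [|Y x|^4 = <x, Y^2 x>^2 <= |x|^2 |Y^2 x|^2]. *)
Lemma dot_pow_trace (s : nat) Y x : Y^T = Y ->
  dot (Y *m x) (Y *m x) ^+ (2 ^ s) <= dot x x ^+ (2 ^ s) * \tr (Y ^+ (2 ^ s.+1)).
Proof.
elim: s Y => [|s IH] Y YT; first by rewrite !expr1; exact: dot_frobenius.
have Y2T : (Y ^+ 2)^T = Y ^+ 2 by rewrite expr2 -[_ * _]/(Y *m Y) trmx_mul YT.
have h : dot (Y *m x) (Y *m x) ^+ 2 <= dot x x * dot (Y ^+ 2 *m x) (Y ^+ 2 *m x).
  rewrite dot_symm // mulmxA; exact: dot_cauchy_schwarz.
rewrite [(2 ^ s.+1)%N]expnS exprM.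
apply: (@le_trans _ _ ((dot x x * dot (Y ^+ 2 *m x) (Y ^+ 2 *m x)) ^+ (2 ^ s))).
  by apply: lerXn2r; rewrite ?nnegrE ?exprn_ge0 ?mulr_ge0 ?dot_ge0.
rewrite exprMn mul2n -addnn exprD -mulrA ler_wpM2l ?exprn_ge0 ?dot_ge0 //.
by rewrite [(2 ^ s.+2)%N]expnS exprM; exact: IH.
Qed.

Lemma dot_mulmx_le (s : nat) Y (mu : R) x : Y^T = Y -> 0 <= mu ->
  \tr (Y ^+ (2 ^ s.+1)) <= mu ^+ (2 ^ s.+1) ->
  dot (Y *m x) (Y *m x) <= mu ^+ 2 * dot x x.
Proof.
move=> YT mu0 h; have := dot_pow_trace s x YT.
move=> /le_trans/(_ (ler_wpM2l (exprn_ge0 _ (dot_ge0 x)) h)).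
rewrite expnS exprM -exprMn mulrC.
by rewrite ler_pXn2r ?nnegrE ?dot_ge0 ?mulr_ge0 ?exprn_ge0 ?dot_ge0 // expn_gt0.
Qed.

(** The power is the square of a symmetric matrix, so its trace is a sum of squares. Markov's
    inequality needs this sign. *)
Lemma trace_pow_ge0 (s : nat) Y : Y^T = Y -> 0 <= \tr (Y ^+ (2 ^ s.+1)).
Proof.
move=> YT; have ZT : (Y ^+ (2 ^ s))^T = Y ^+ (2 ^ s).
  elim: (2 ^ s)%N => [|k IH]; first by rewrite expr0 trmx1.
  by rewrite {1}exprS exprSr -[_ * _]/(_ *m _) trmx_mul YT IH.
rewrite expnSr exprM; apply: sumr_ge0 => i _.
rewrite expr2 -[_ * _]/(_ *m _) mxE; apply: sumr_ge0 => j _.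
by rewrite -[in X in _ * X]ZT mxE -expr2 sqr_ge0.
Qed.

End SymmetricMatrices.

(** * Chernoff bounds for the degrees *)

Section Chernoff.
Variables (R : realType) (n : nat) (p : R).
Hypothesis p01 : 0 <= p <= 1.
Implicit Types (w : config n).

(** Invert e^(-t) >= 1 - t; then (1 + t + 2 t^2)(1 - t) = 1 + t^2 (1 - 2 t) >= 1. Negative [t] is
    included, so both tails are served. *)
Lemma expR_le (t : R) : t <= 2^-1 -> expR t <= 1 + t + 2 * t ^+ 2.
Proof.
move=> t2; have h : 1 - t <= expR (- t) by exact: expR_ge1Dx.
have t1 : 0 < 1 - t by lra.
rewrite -[t in expR t]opprK expRN.
apply: (@le_trans _ _ (1 - t)^-1); first by rewrite lef_pV2 ?posrE // (lt_le_trans t1).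
rewrite -[_^-1]mul1r ler_pdivrMr //.
have : 0 <= t ^+ 2 * (1 - 2 * t) by rewrite mulr_ge0 ?sqr_ge0 //; lra.
by nra.
Qed.

Lemma bernoulli_mgf (t : R) : t <= 2^-1 ->
  p * expR (t * (1 - p)) + (1 - p) * expR (t * - p) <= expR (2 * p * t ^+ 2).
Proof.
move=> t2; move: p01 => /andP[p0 p1].
have -> : t * (1 - p) = t + t * - p by ring.
rewrite expRD.
have -> : p * (expR t * expR (t * - p)) + (1 - p) * expR (t * - p) =
  (1 + p * (expR t - 1)) * expR (t * - p) by ring.
have -> : 2 * p * t ^+ 2 = p * (t + 2 * t ^+ 2) + t * - p by ring.
rewrite expRD ler_wpM2r ?expR_ge0 //; apply: le_trans (expR_ge1Dx _).
by rewrite lerD2l ler_wpM2l //; have := expR_le t2; lra.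
Qed.

(** The degree of [i] minus its mean (n-1) p, the diagonal of [centered] being 0. *)
Definition degree_dev w i : R := \sum_j centered p w i j.

Lemma degree_devE w i : degree_dev w i = \sum_(e | incident e i) ((w e)%:R - p).
Proof.
transitivity (\sum_j centered p w i j * 1); first by apply: eq_bigr => j _; rewrite mulr1.
by rewrite (sum_centered p w i (fun=> 1)); apply: eq_bigr => e _; rewrite mulr1.
Qed.

Lemma expect_degree_dev i (t : R) : t <= 2^-1 ->
  expect p (fun w => expR (t * degree_dev w i)) <= expR (2 * (n%:R * p) * t ^+ 2).
Proof.
move=> t2; move: (p01) => /andP[p0 p1].
pose G (e : edge_t n) (b : bool) : R := if incident e i then expR (t * (b%:R - p)) else 1.
rewrite (_ : expect p _ = expect p (fun w => \prod_e G e (w e))); last first.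
  apply: eq_bigr => w _; congr (_ * _).
  rewrite degree_devE.
  by rewrite big_distrr /= expR_sum big_mkcond /=.
rewrite expect_prod //.
apply: (@le_trans _ _ (\prod_(e : edge_t n)
    (if incident e i then expR (2 * p * t ^+ 2) else 1))).
  apply: ler_prod => e _; rewrite /G; case: ifP => _; rewrite big_bool /=.
    rewrite addr_ge0 ?mulr_ge0 ?expR_ge0 ?subr_ge0 //=.
    by have := bernoulli_mgf t2; rewrite sub0r.
  by rewrite !mulr1 addrC subrK lexx ler01.
rewrite -big_mkcond /= -expR_sum ler_expR sumr_const -[leLHS]mulr_natl.
have -> : 2 * (n%:R * p) * t ^+ 2 = n%:R * (2 * p * t ^+ 2) by ring.
apply: ler_wpM2r; first by rewrite mulr_ge0 ?sqr_ge0 // mulr_ge0.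
rewrite ler_nat -sum1_card.
have := sum_other_le (fun=> 1%N) i xpredT; rewrite [leqRHS]sum_nat_const card_ord muln1.
by apply: leq_trans; apply: eq_leq; apply: eq_bigl => e; rewrite andbT.
Qed.

End Chernoff.

(** * Kernel vectors of the Ihara matrix *)

Section Kernel.
Variables (R : realType) (n : nat).
Implicit Types (w : config n) (x y : 'cV[R]_n) (v : R[i]).

Definition adj w : 'M[R]_n := \matrix_(i, j) (adjb w i j)%:R.
(* Degree minus one: the diagonal of [B - I]. *)
Definition deg1 w (j : 'I_n) : R := \sum_k (adjb w j k)%:R - 1.

Lemma adjbC w i j : adjb w i j = adjb w j i.
Proof. by apply: eq_existsb => e; rewrite orbC. Qed.

Lemma adjb_irrefl w i : adjb w i i = false.
Proof.
apply/existsP => -[e /andP[h _]]; move: (ends_neq e).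
by rewrite orbb in h; rewrite (eqP h) eqxx.
Qed.

Lemma adj_sym w : (adj w)^T = adj w.
Proof. by apply/matrixP => i j; rewrite !mxE adjbC. Qed.

Lemma sum_complex (I : finType) (f g : I -> R) :
  \sum_i (f i +i* g i)%C = ((\sum_i f i) +i* (\sum_i g i))%C.
Proof. by elim/big_rec3: _ => // i a b c _ ->. Qed.

Lemma ihara_kernel w (u : R[i]) :
  \det (1%:M + u ^+ 2 *: (degmx R w - 1%:M) - u *: adjmx R w) = 0 ->
  exists x y, [/\ 0 < dot x x + dot y y &
    forall j, let a := complex.Re u in let b := complex.Im u in
      let e := deg1 w j in
      x j 0 * (1 + (a ^+ 2 - b ^+ 2) * e) - y j 0 * (2 * a * b * e) =
        a * (adj w *m x) j 0 - b * (adj w *m y) j 0 /\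
      x j 0 * (2 * a * b * e) + y j 0 * (1 + (a ^+ 2 - b ^+ 2) * e) =
        a * (adj w *m y) j 0 + b * (adj w *m x) j 0].
Proof.
(* [det0P] yields a row vector; symmetry of the adjacency matrix turns it into column equations.
   Real and imaginary parts are separated so that later algebra is over [R]. *)
move/eqP/det0P => [z z0 zM].
pose x := \col_i complex.Re (z 0 i) : 'cV[R]_n.
pose y := \col_i complex.Im (z 0 i) : 'cV[R]_n.
have zE i : z 0 i = (x i 0 +i* y i 0)%C by rewrite !mxE; case: (z 0 i).
exists x, y; split=> [|j a b e].
  have xy i : 0 <= x i 0 * x i 0 + y i 0 * y i 0 by rewrite -!expr2 addr_ge0 ?sqr_ge0.
  have Exy : dot x x + dot y y = \sum_i (x i 0 * x i 0 + y i 0 * y i 0).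
    by rewrite /dot big_split.
  rewrite lt_neqAle Exy sumr_ge0 // andbT eq_sym; apply: contraNneq z0 => h.
  apply/eqP/matrixP => i j; rewrite ord1 mxE zE.
  have hj : x j 0 * x j 0 + y j 0 * y j 0 = 0.
    exact: (psumr_eq0P (fun i _ => xy i) h isT).
  move/eqP: hj; rewrite -!expr2 paddr_eq0 ?sqr_ge0 // !sqrf_eq0 => /andP[/eqP-> /eqP->].
  by [].
have zj : z 0 j * (1 + u ^+ 2 * e%:C%C) = u * \sum_i ((adjb w j i)%:R)%:C%C * z 0 i.
  have /matrixP/(_ 0 j) := zM; rewrite !mxE.
  under eq_bigr => i _ do rewrite !mxE.
  move=> h; apply/eqP; rewrite -subr_eq0; apply/eqP; rewrite -[RHS]h.
  have -> : u * \sum_i ((adjb w j i)%:R)%:C%C * z 0 i = \sum_i z 0 i * (u * (adjb w i j)%:R).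
    by rewrite big_distrr; apply: eq_bigr => i _; rewrite adjbC rmorph_nat /=; ring.
  have -> : z 0 j * (1 + u ^+ 2 * e%:C%C) = \sum_i z 0 i *
     ((i == j)%:R + u ^+ 2 * ((i == j)%:R * (\sum_k (adjb w i k)%:R) - (i == j)%:R)).
    have -> : e%:C%C = \sum_k (adjb w j k)%:R - 1.
      rewrite /e /deg1 rmorphB rmorph_sum rmorph1 /=; congr (_ - _).
      by apply: eq_bigr => k _; rewrite rmorph_nat.
    rewrite [RHS](bigD1 j) //= eqxx mul1r [X in _ = _ + X]big1 ?addr0 // => i ij.
    by rewrite (negbTE ij) mul0r subrr mulr0 addr0 mulr0.
  rewrite -sumrB; apply: eq_bigr => i _.
  under [in RHS]eq_bigr => k _ do rewrite mxE.
  by ring.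
have sE : \sum_i ((adjb w j i)%:R)%:C%C * z 0 i =
    ((adj w *m x) j 0 +i* (adj w *m y) j 0)%C.
  rewrite [X in (X +i* _)%C]mxE [X in (_ +i* X)%C]mxE -sum_complex.
  apply: eq_bigr => i _; rewrite zE [adj w j i]mxE.
  by apply/eqP; rewrite eq_complex /= !mul0r subr0 addr0 !eqxx.
rewrite sE zE (_ : u = (a +i* b)%C) in zj; last by rewrite /a /b; case: (u).
split; [have := congr1 (@complex.Re R) zj|have := congr1 (@complex.Im R) zj]; rewrite expr2 /=; lra.
Qed.

(** The exponent may be negative, but an integer power of 1 - u^2 vanishes only if its base does. *)
Lemma zeta_inv_eq0 (rho : R) w v : let u := v / (Num.sqrt rho)%:C%C in
  u ^+ 2 != 1 -> zeta_inv rho w v = 0 ->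
  \det (1%:M + u ^+ 2 *: (degmx R w - 1%:M) - u *: adjmx R w) = 0.
Proof.
move=> u u1 /eqP; rewrite /zeta_inv -/u mulf_eq0 => /orP[|/eqP //].
by rewrite expfz_eq0 => /andP[_]; rewrite subr_eq0 eq_sym (negbTE u1).
Qed.

End Kernel.

(** * Kernel vectors under a norm bound and nearly regular degrees *)

Section Deterministic.
Variables (R : realType) (n : nat) (rho delta mu : R) (w : config n).
Hypothesis rho_gt0 : 0 < rho.
Hypothesis rho_lt : rho < n%:R.
Let p := rho / n%:R.
Let C := centered p w.
Hypothesis mu_ge0 : 0 <= mu.
Hypothesis C_le : forall x, dot (C *m x) (C *m x) <= mu ^+ 2 * dot x x.
Hypothesis dev_le : forall i, `|degree_dev p w i| <= delta * rho.
Implicit Types x y : 'cV[R]_n.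

Let n_gt0 : 0 < n%:R :> R. Proof. exact: lt_trans rho_lt. Qed.
Let p_ge0 : 0 <= p. Proof. by rewrite divr_ge0 // ltW. Qed.
Let p_le1 : p <= 1. Proof. by rewrite ler_pdivrMr // mul1r ltW. Qed.
Let pnE : p * n%:R = rho. Proof. by rewrite divfK // gt_eqF. Qed.
Let one : 'cV[R]_n := const_mx 1.

(** A = C + p (J - I), with J the all-ones matrix. *)
Lemma adj_mulmx x i : (adj R w *m x) i 0 = (C *m x) i 0 + p * (\sum_j x j 0 - x i 0).
Proof.
rewrite !mxE (bigD1 i) //= mxE adjb_irrefl mul0r add0r.
rewrite [in RHS](bigD1 i) //= mxE eqxx mul0r add0r [in X in p * X](bigD1 i) //=.
rewrite addrAC subrr add0r big_distrr -big_split /=; apply: eq_bigr => j ji.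
by rewrite !mxE eq_sym (negbTE ji); ring.
Qed.

Lemma deg1E i : deg1 R w i = degree_dev p w i + rho - p - 1.
Proof.
have := adj_mulmx one i; rewrite !mxE.
under eq_bigr do rewrite !mxE mulr1.
under [X in _ = X + _]eq_bigr do rewrite [one _ _]mxE mulr1.
under [X in _ = _ + _ * (X - _)]eq_bigr do rewrite mxE.
rewrite sumr_const card_ord mulrBr mulr1 pnE => E.
by rewrite /deg1 E /degree_dev addrA.
Qed.

Lemma dot_adj x : dot x (adj R w *m x) =
  dot x (C *m x) + p * ((\sum_j x j 0) ^+ 2 - dot x x).
Proof.
rewrite {1}/dot; under eq_bigr do rewrite adj_mulmx mulrDr.
rewrite big_split /=; congr (_ + _).
rewrite expr2 [X in X - _]big_distrl -sumrB big_distrr /=; apply: eq_bigr => i _; ring.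
Qed.

Lemma dot_C_le x : `|dot x (C *m x)| <= mu * dot x x.
Proof.
rewrite -(@ler_pXn2r _ 2) ?nnegrE ?normr_ge0 ?mulr_ge0 ?dot_ge0 // real_normK ?num_real //.
apply: le_trans (dot_cauchy_schwarz _ _) _.
apply: (@le_trans _ _ (dot x x * (mu ^+ 2 * dot x x))); last by rewrite le_eqVlt; apply/orP; left; apply/eqP; ring.
by rewrite ler_wpM2l ?dot_ge0.
Qed.

(** The deviations form the vector C 1, of squared norm at most mu^2 n. *)
Lemma sum_dev_sqr x : (\sum_j degree_dev p w j * x j 0) ^+ 2 <= mu ^+ 2 * n%:R * dot x x.
Proof.
have -> : \sum_j degree_dev p w j * x j 0 = dot (C *m one) x.
  apply: eq_bigr => j _; congr (_ * _); rewrite mxE; apply: eq_bigr => k _.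
  by rewrite [one _ _]mxE mulr1.
apply: le_trans (dot_cauchy_schwarz _ _) _; rewrite ler_wpM2r ?dot_ge0 //.
apply: le_trans (C_le _) _; rewrite /dot; under eq_bigr do rewrite !mxE mulr1.
by rewrite sumr_const card_ord.
Qed.

(** The bilinear form of B - I. *)
Definition wdot x y : R := \sum_j deg1 R w j * (x j 0 * y j 0).

(** The added 2 / rho absorbs the -p - 1 of [deg1E]. *)
Let delta' := delta + 2 / rho.

Lemma wdot_bounds x :
  rho * (1 - delta') * dot x x <= wdot x x <= rho * (1 + delta') * dot x x.
Proof.
have r0 : rho != 0 by rewrite gt_eqF.
have dE : rho * delta' = delta * rho + 2 by rewrite /delta'; field.
have p1 := p_le1; have p0 := p_ge0.
rewrite /dot /wdot !big_distrr /=; apply/andP; split; apply: ler_sum => j _;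
  rewrite ler_wpM2r -?expr2 ?sqr_ge0 // deg1E;
  have := dev_le j; rewrite ler_norml => /andP[]; lra.
Qed.

Lemma nonreal_kernel x y (a b : R) : 0 < dot x x + dot y y -> b != 0 ->
  (forall j, x j 0 * (1 + (a ^+ 2 - b ^+ 2) * deg1 R w j) - y j 0 * (2 * a * b * deg1 R w j) =
        a * (adj R w *m x) j 0 - b * (adj R w *m y) j 0 /\
      x j 0 * (2 * a * b * deg1 R w j) + y j 0 * (1 + (a ^+ 2 - b ^+ 2) * deg1 R w j) =
        a * (adj R w *m y) j 0 + b * (adj R w *m x) j 0) ->
  (a ^+ 2 + b ^+ 2) * rho * (1 - delta') <= 1 <= (a ^+ 2 + b ^+ 2) * rho * (1 + delta').
Proof.
move=> S0 b0 h.
pose S := dot x x + dot y y; pose B := wdot x x + wdot y y.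
pose Q := dot x (adj R w *m x) + dot y (adj R w *m y).
have sym : dot y (adj R w *m x) = dot x (adj R w *m y).
  by rewrite dotC dot_symm // adj_sym.
(* Pairing with x + i y gives [S] + u^2 [B] - u [Q] = 0, where symmetry of A makes [Q] real. This is
   its real part; [e2] is its imaginary part divided by [b]. *)
have e1 : S + (a ^+ 2 - b ^+ 2) * B = a * Q.
  have -> : S + (a ^+ 2 - b ^+ 2) * B = a * Q + b * (dot y (adj R w *m x) - dot x (adj R w *m y)).
    rewrite /S /B /Q /dot /wdot -!big_split /= -sumrB !big_distrr -!big_split /=.
    apply: eq_bigr => j _; have [h1 h2] := h j.
    have E1 := congr1 (fun z => x j 0 * z) h1; have E2 := congr1 (fun z => y j 0 * z) h2.
    rewrite /= in E1 E2; lra.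
  by rewrite sym subrr mulr0 addr0.
have e2 : 2 * a * B = Q.
  apply: (mulfI b0).
  have -> : b * (2 * a * B) = b * Q + a * (dot x (adj R w *m y) - dot y (adj R w *m x)).
    rewrite /B /Q /dot /wdot -!big_split /= -sumrB !big_distrr -!big_split /=.
    apply: eq_bigr => j _; have [h1 h2] := h j.
    have E1 := congr1 (fun z => y j 0 * z) h1; have E2 := congr1 (fun z => x j 0 * z) h2.
    rewrite /= in E1 E2; lra.
  by rewrite sym subrr mulr0 addr0.
(* Eliminating [Q] gives S = |u|^2 B, the product of two conjugate roots. *)
have e3 : S = (a ^+ 2 + b ^+ 2) * B by move: e1; rewrite -e2; lra.
have /andP[l1 u1] := wdot_bounds x; have /andP[l2 u2] := wdot_bounds y.
have ab : 0 <= a ^+ 2 + b ^+ 2 by rewrite addr_ge0 ?sqr_ge0.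
have lB : rho * (1 - delta') * S <= B by rewrite mulrDr lerD.
have uB : B <= rho * (1 + delta') * S by rewrite mulrDr lerD.
apply/andP; split; rewrite -(ler_pM2r S0) mul1r -/S.
  by have := ler_wpM2l ab lB; rewrite -e3; lra.
by have := ler_wpM2l ab uB; rewrite -e3; lra.
Qed.

Lemma real_kernel x (a kappa : R) : 0 < dot x x -> `|a| < 1 -> 0 < kappa -> 4 <= kappa * rho ->
  mu ^+ 2 <= 9 * rho -> (0 < a -> 1 < a * rho * (1 - kappa)) ->
  (forall j, x j 0 * (1 + a ^+ 2 * deg1 R w j) = a * (adj R w *m x) j 0) ->
  1 + a ^+ 2 * rho * (1 - delta') <= `|a| * (mu + 1 + 36 / kappa ^+ 2).
Proof.
move=> S0 a1 k0 kr m9 apos h.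
pose S := dot x x; pose s := \sum_j x j 0.
have e1 : S + a ^+ 2 * wdot x x = a * dot x (adj R w *m x).
  rewrite /S /wdot /dot !big_distrr -big_split /=; apply: eq_bigr => j _.
  have := congr1 (fun z => x j 0 * z) (h j) => /=; lra.
(* Pairing with the vector 1, using that A 1 is the degree vector. *)
have e2 : s + a ^+ 2 * \sum_j deg1 R w j * x j 0 = a * \sum_j (deg1 R w j + 1) * x j 0.
  have -> : \sum_j (deg1 R w j + 1) * x j 0 = dot (adj R w *m one) x.
    apply: eq_bigr => j _; congr (_ * _); rewrite /deg1 subrK mxE; apply: eq_bigr => k _.
    by rewrite !mxE mulr1.
  rewrite dot_symm ?adj_sym // /dot /s !big_distrr -big_split /=; apply: eq_bigr => j _.
  by rewrite [one _ _]mxE mul1r -(h j); ring.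
pose xi := \sum_j degree_dev p w j * x j 0.
have e3 : s * (1 - a * (rho - p - 1)) = a * xi.
  have sE : \sum_j deg1 R w j * x j 0 = xi + (rho - p - 1) * s.
    rewrite /xi /s big_distrr -big_split /=; apply: eq_bigr => j _.
    by rewrite deg1E; ring.
  have sE1 : \sum_j (deg1 R w j + 1) * x j 0 = xi + (rho - p - 1) * s + s.
    by rewrite -sE -big_split /=; apply: eq_bigr => j _; ring.
  rewrite sE sE1 in e2.
  (* The identity has the factor 1 - a from the trivial zero u = 1; it can be cancelled as |a| <
     1. *)
  have na : 1 - a != 0.
    by rewrite subr_eq0; apply: contraTneq a1 => <-; rewrite normr1 ltxx.
  apply: (mulfI na); lra.
have xi2 : xi ^+ 2 <= mu ^+ 2 * n%:R * S by exact: sum_dev_sqr.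
have := dot_adj x; rewrite -/S -/s => dE.
have := dot_C_le x; rewrite -/S ler_norml => /andP[dl du].
have /andP[bl _] := wdot_bounds x; rewrite -/S in bl.
have S0' : 0 < S by [].
have p0 := p_ge0; have p1 := p_le1.
have k2 : 0 <= 36 / kappa ^+ 2 by rewrite divr_ge0 ?sqr_ge0.
have bl2 := ler_wpM2l (sqr_ge0 a) bl.
rewrite -(ler_pM2r S0').
(* For [a <= 0] the term a p s^2 already has the favourable sign. *)
have [a_le0|a_gt0] := lerP a 0.
  rewrite ler0_norm //.
  have h1 : a * (p * s ^+ 2) <= 0 by rewrite mulr_le0_ge0 // mulr_ge0 ?sqr_ge0.
  have h2 : 0 <= - a * (dot x (C *m x) + mu * S).
    by rewrite mulr_ge0; lra.
  have h3 : 0 <= - a * S * (1 - p) by rewrite !mulr_ge0 //; lra.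
  have h4 : 0 <= - a * S * (36 / kappa ^+ 2).
    by rewrite !mulr_ge0 //; lra.
  rewrite dE in e1; lra.
rewrite gtr0_norm //.
have ar := apos a_gt0.
pose t := a * (rho - p - 1) - 1.
(* The lower bound on [a] gives t > kappa a rho - (1+p) a, and half of the first term absorbs the
   second by p <= 1 and 4 <= kappa rho. *)
have ht : kappa * a * rho / 2 <= t.
  have : 0 <= a * (kappa * rho - 4) by rewrite mulr_ge0 //; lra.
  have : 0 <= a * (1 - p) by rewrite mulr_ge0 //; lra.
  rewrite /t; lra.
have s2 : (kappa * a * rho / 2) ^+ 2 * s ^+ 2 <= a ^+ 2 * (9 * rho * n%:R * S).
  apply: (@le_trans _ _ (t ^+ 2 * s ^+ 2)).
    rewrite ler_wpM2r ?sqr_ge0 // ler_pXn2r ?nnegrE //; first by rewrite !mulr_ge0 // ltW.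
    by apply: le_trans ht; rewrite !mulr_ge0 // ltW.
  have -> : t ^+ 2 * s ^+ 2 = a ^+ 2 * xi ^+ 2.
    by rewrite -[RHS]exprMn -e3 /t; ring.
  apply: ler_wpM2l; first exact: sqr_ge0.
  apply: le_trans xi2 _; apply: ler_wpM2r; first exact: ltW.
  by apply: ler_wpM2r; first exact: ltW.
(* 36 is 4 times 9: the 4 comes from the halving in [ht], the 9 from mu^2 <= 9 rho; p n = rho
   cancels the rest. *)
have s3 : p * s ^+ 2 <= 36 / kappa ^+ 2 * S.
  have c0 : 0 < kappa ^+ 2 * a ^+ 2 * rho ^+ 2 by rewrite !mulr_gt0 // exprn_gt0.
  rewrite -(ler_pM2l c0).
  have -> : kappa ^+ 2 * a ^+ 2 * rho ^+ 2 * (36 / kappa ^+ 2 * S) = p * 4 * (a ^+ 2 * (9 * rho * n%:R * S)).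
    have -> : p * 4 * (a ^+ 2 * (9 * rho * n%:R * S)) = 36 * a ^+ 2 * rho * (p * n%:R) * S by ring.
    by rewrite pnE; field; rewrite gt_eqF.
  have p4 : 0 <= p * 4 by rewrite mulr_ge0.
  have := ler_wpM2l p4 s2; lra.
have h1 := ler_wpM2l (ltW a_gt0) s3.
have h2 : 0 <= a * (mu * S - dot x (C *m x)).
  by rewrite mulr_ge0 //; lra.
have h3 : 0 <= a * (p * S) by rewrite !mulr_ge0 // ltW.
have h4 : 0 <= a * S by rewrite mulr_ge0 // ltW.
rewrite dE in e1; lra.
Qed.

End Deterministic.

(** * Inequalities for the modulus in the two domains *)

Section DomainInequalities.
Variables (R : realFieldType) (t eps delta eta : R).
(** Throughout, [t] is |v|. This lemma and [outer_modulus] contradict [nonreal_kernel]; the other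
    two contradict [real_kernel]. *)
Lemma inner_modulus : 0 < eps -> eps <= 2^-1 -> 0 <= delta -> 0 <= eta ->
  delta + eta <= eps ^+ 2 / 4 -> 0 <= t -> t < 1 - eps -> t ^+ 2 * (1 + delta) < 1.
Proof.
move=> eps_gt0 eps_le delta_ge0 eta_ge0 small t0 t1.
have h1 : t ^+ 2 <= (1 - eps) ^+ 2 by rewrite ler_pXn2r ?nnegrE //; lra.
have h2 : 0 <= eps * (1 - eps) by rewrite mulr_ge0 //; lra.
have d4 : delta <= eps ^+ 2 / 4 by lra.
have e2 : eps ^+ 2 <= eps by rewrite expr2; lra.
have h3 : t ^+ 2 <= 1 - eps by lra.
have h4 : t ^+ 2 * (1 + delta) <= (1 - eps) * (1 + eps / 4).
  by apply: ler_pM; rewrite ?sqr_ge0 //; lra.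
by have := sqr_ge0 eps; lra.
Qed.

Lemma outer_modulus : 0 < eps -> eps <= 2^-1 -> 0 <= delta -> 0 <= eta ->
  delta + eta <= eps ^+ 2 / 4 -> 1 + eps < t -> 1 < t ^+ 2 * (1 - delta).
Proof.
move=> eps_gt0 eps_le delta_ge0 eta_ge0 small t1.
have h1 : (1 + eps) ^+ 2 <= t ^+ 2 by rewrite ler_pXn2r ?nnegrE //; lra.
have d4 : delta <= eps ^+ 2 / 4 by lra.
have h2 : 0 <= eps * (1 - eps) by rewrite mulr_ge0 //; lra.
have e2 : eps ^+ 2 <= eps by rewrite expr2; lra.
have h3 : 1 + 2 * eps <= t ^+ 2 by have := sqr_ge0 eps; lra.
have h4 : (1 + 2 * eps) * (1 - eps / 4) <= t ^+ 2 * (1 - delta).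
  by apply: ler_pM => //; lra.
by lra.
Qed.

(** As t < 1, the errors t^2 delta + t eta are at most delta + eta, less than (1 - t)^2 > eps^2. *)
Lemma inner_real : 0 < eps -> eps <= 2^-1 -> 0 <= delta -> 0 <= eta ->
  delta + eta <= eps ^+ 2 / 4 -> 0 <= t -> t < 1 - eps -> t * (2 + eta) < 1 + t ^+ 2 * (1 - delta).
Proof.
move=> eps_gt0 eps_le delta_ge0 eta_ge0 small t0 t1.
have h1 : eps ^+ 2 < (1 - t) ^+ 2 by rewrite ltr_pXn2r ?nnegrE //; lra.
have h2 : t ^+ 2 * delta <= delta by rewrite ler_piMl // exprn_ile1 //; lra.
have h3 : t * eta <= eta by rewrite ler_piMl //; lra.
have := sqr_ge0 eps; lra.
Qed.

(** Here [t] is unbounded, so the errors are measured against t^2: t - 1 > t eps / 2 gives (t - 1)^2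
    > t^2 eps^2 / 4, the origin of the budget eps^2 / 4. *)
Lemma outer_real : 0 < eps -> eps <= 2^-1 -> 0 <= delta -> 0 <= eta ->
  delta + eta <= eps ^+ 2 / 4 -> 1 + eps < t -> t * (2 + eta) < 1 + t ^+ 2 * (1 - delta).
Proof.
move=> eps_gt0 eps_le delta_ge0 eta_ge0 small t1.
have h0 : 0 <= t - 1 - eps by lra.
have h1 : (t * (eps / 2)) ^+ 2 < (t - 1) ^+ 2.
  rewrite ltr_pXn2r ?nnegrE ?mulr_ge0 //; try lra.
  have : 0 <= (t - 1 - eps) * (1 - eps) by rewrite mulr_ge0 //; lra.
  have : 0 <= eps * (1 - eps) by rewrite mulr_ge0 //; lra.
  by lra.
have h2 : t * eta <= t ^+ 2 * eta by rewrite ler_wpM2r // expr2 ler_peMl; lra.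
have h3 := ler_wpM2l (sqr_ge0 t) small.
have -> : t ^+ 2 * (1 - delta) = t ^+ 2 - t ^+ 2 * delta by ring.
by lra.
Qed.

End DomainInequalities.

Lemma zeta_inv_neq0 (R : realType) (n : nat) (rho delta mu kappa eps eta : R)
    (w : config n) (v : R[i]) :
  0 < rho < n%:R -> 0 < kappa < 1 -> 4 <= kappa * rho ->
  0 <= mu -> mu ^+ 2 <= 9 * rho ->
  0 < eps <= 2^-1 -> 0 <= delta -> 0 <= eta ->
  delta + 2 / rho + eta <= eps ^+ 2 / 4 ->
  mu + 1 + 36 / kappa ^+ 2 <= (2 + eta) * Num.sqrt rho ->
  (forall x, dot (centered (rho / n%:R) w *m x) (centered (rho / n%:R) w *m x) <=
     mu ^+ 2 * dot x x) ->
  (forall i, `|degree_dev (rho / n%:R) w i| <= delta * rho) ->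
  let eps' := 1 / (Num.sqrt rho * (1 - kappa)) in
  dom1 eps eps' v \/ dom2 eps eps' v -> zeta_inv rho w v != 0.
Proof.
move=> /andP[r0 rn] /andP[k0 k1] kr mu0 mu9 /andP[e0 e1] d0 eta0 small hmu hC hdev eps' hv.
have rS0 : 0 < Num.sqrt rho by rewrite sqrtr_gt0.
have rSE : Num.sqrt rho ^+ 2 = rho by rewrite sqr_sqrtr // ltW.
set s := Num.sqrt rho in rS0 rSE hmu eps' hv *.
pose c := complex.Re v; pose d := complex.Im v; pose t := Num.sqrt (c ^+ 2 + d ^+ 2).
have t0 : 0 <= t by exact: sqrtr_ge0.
have tE : t ^+ 2 = c ^+ 2 + d ^+ 2 by rewrite sqr_sqrtr // addr_ge0 ?sqr_ge0.
have r4 : 4 < rho.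
  by have := mulr_gt0 r0 (_ : 0 < 1 - kappa); rewrite subr_gt0 => /(_ k1); lra.
have s2 : 2 < s.
  rewrite -(@ltr_pXn2r _ 2) ?nnegrE ?ler0n ?(ltW rS0) // rSE; lra.
(* In the outer domain 1 / eps' > |v| > 1, so eps' < 1 and |v| > eps' holds there too. *)
have ht : eps' < t /\ (t < 1 - eps \/ (1 + eps < t /\ t < s * (1 - kappa))).
  case: hv; rewrite /dom1 /dom2 normc_def -/c -/d -/t !ltcR => -[h1 h2].
    by split => //; left.
  have e'E : 1 / eps' = s * (1 - kappa) by rewrite /eps' div1r div1r invrK.
  rewrite e'E in h2; split; last by right.
  apply: le_lt_trans (_ : 1 + eps < t) => //.
  rewrite /eps' ler_pdivrMr ?mulr_gt0 ?subr_gt0 //.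
  have h3 : 1 < s * (1 - kappa) by apply: lt_trans h2; lra.
  have := mulr_gt0 e0 (lt_trans ltr01 h3); lra.
case: ht => te ht.
have ts : t < s.
  case: ht => [|[_]]; first lra.
  by move/lt_le_trans; apply; rewrite ger_pMr //; lra.
have ek : 0 < s * (1 - kappa) by rewrite mulr_gt0 // subr_gt0.
have te1 : 1 < t * s * (1 - kappa).
  by move: te; rewrite /eps' ltr_pdivrMr // mulrA.
have s0' : s != 0 by rewrite gt_eqF.
pose u := v / s%:C%C; pose a := c / s; pose b := d / s.
have uE : u = (a +i* b)%C.
  rewrite /u -fmorphV /= /a /b /c /d; case: (v) => v1 v2.
  by apply/eqP; rewrite eq_complex /= !mulr0 subr0 add0r !eqxx.
have abE : (a ^+ 2 + b ^+ 2) * rho = t ^+ 2.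
  by rewrite tE -rSE /a /b; field.
have dd : 0 <= delta + 2 / rho by rewrite addr_ge0 // divr_ge0 // ltW.
apply/negP => /eqP hz.
(* u^2 = 1 would force |v| = sqrt rho, beyond both domains. *)
have u1 : u ^+ 2 != 1.
  apply/eqP; rewrite uE expr2 => h.
  have h1 := congr1 (@complex.Re R) h; have h2 := congr1 (@complex.Im R) h.
  rewrite /= in h1 h2.
  have h3 : a * b = 0 by clear -h2; lra.
  have b0 : b = 0.
    move/eqP: h3; rewrite mulf_eq0 => /orP[/eqP az|/eqP //].
    by have := sqr_ge0 b; rewrite az in h1; rewrite expr2; clear -h1; lra.
  have a2 : a ^+ 2 = 1 by rewrite b0 in h1; rewrite expr2; clear -h1; lra.
  have : t ^+ 2 = rho by rewrite -abE b0 a2 expr0n addr0 mul1r.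
  have : t ^+ 2 < s ^+ 2 by rewrite ltr_pXn2r ?nnegrE // ltW.
  by rewrite rSE => h5 h6; move: h5; rewrite h6 ltxx.
have [x [y [xy0 hxy]]] := ihara_kernel (zeta_inv_eq0 u1 hz).
have [b0|b0] := eqVneq b 0; last first.
  have := @nonreal_kernel R n rho delta w r0 rn hdev x y a b xy0 b0.
  have hxy' := hxy; rewrite -/s -/u uE /= in hxy'.
  move=> /(_ hxy') /andP[]; rewrite abE => l1 l2.
  case: ht => [ht|[ht _]].
    by have := inner_modulus e0 e1 dd eta0 small t0 ht; clear -l2; lra.
  by have := outer_modulus e0 e1 dd eta0 small ht; clear -l1; lra.
(* For real u the equations for [x] and [y] decouple, and one of the two vectors is nonzero. *)
have hx : exists2 z : 'cV[R]_n, 0 < dot z z &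
    forall j, z j 0 * (1 + a ^+ 2 * deg1 R w j) = a * (adj R w *m z) j 0.
  have hxy' j := hxy j; rewrite -/s -/u uE b0 /= in hxy'.
  have [x0|x0] := ltrP 0 (dot x x).
    exists x => // j; have [h1 _] := hxy' j.
    by move: h1; rewrite expr0n /= subr0 !mulr0 !mul0r mulr0 !subr0.
  exists y => [|j]; first by clear -xy0 x0; lra.
  have [_ h1] := hxy' j.
  by move: h1; rewrite expr0n /= subr0 !mulr0 !mul0r mulr0 add0r addr0.
have [z z0 hz'] := hx.
have asE : `|a| * s = t.
  have as0 : 0 <= `|a| * s by apply: mulr_ge0 => //; exact: ltW.
  apply/eqP; rewrite -(@eqrXn2 _ 2) //.
  by rewrite exprMn real_normK ?num_real // rSE -abE b0 expr0n addr0.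
have a1 : `|a| < 1 by rewrite -(ltr_pM2r rS0) asE mul1r.
have apos : 0 < a -> 1 < a * rho * (1 - kappa).
  by move=> a0; rewrite -rSE expr2 mulrA -[X in X * s](gtr0_norm (mulr_gt0 a0 rS0)) normrM (gtr0_norm rS0) asE.
have := @real_kernel R n rho delta mu w r0 rn mu0 hC hdev z a kappa z0 a1 k0 kr mu9 apos hz'.
have a2E : a ^+ 2 * rho = t ^+ 2 by rewrite -abE b0 expr0n addr0.
rewrite a2E => h1.
have h2 : `|a| * (mu + 1 + 36 / kappa ^+ 2) <= t * (2 + eta).
  by rewrite -asE -mulrA [s * _]mulrC ler_wpM2l ?normr_ge0.
case: ht => [ht|[ht _]].
  by have := inner_real e0 e1 dd eta0 small t0 ht; clear -h1 h2; lra.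
by have := outer_real e0 e1 dd eta0 small ht; clear -h1 h2; lra.
Qed.

(** * Probability estimates *)

Section ProbabilityBound.
Variables (R : realType) (n : nat).
Implicit Types (p : R) (F G : config n -> R).

Lemma expectD p F G : expect p (fun w => F w + G w) = expect p F + expect p G.
Proof. by rewrite /expect -big_split; apply: eq_bigr => w _; rewrite mulrDr. Qed.

Lemma expectZ p (a : R) F : expect p (fun w => F w * a) = expect p F * a.
Proof. by rewrite /expect big_distrl; apply: eq_bigr => w _; rewrite mulrA. Qed.

Lemma centered_sym p (w : config n) : (centered p w)^T = centered p w.
Proof. by apply/matrixP => i j; rewrite !mxE eq_sym adjbC. Qed.

Lemma ER_prob_ge0 (rho : R) (E : config n -> Prop) : 0 <= rho / n%:R <= 1 ->
  0 <= ER_prob n rho E.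
Proof. by move=> p01; apply: sumr_ge0 => w _; case: asboolP => // _; exact: config_weight_ge0. Qed.

Lemma ER_prob_le_expect (rho : R) (E : config n -> Prop) F : 0 <= rho / n%:R <= 1 ->
  (forall w, 0 <= F w) -> (forall w, E w -> 1 <= F w) ->
  ER_prob n rho E <= expect (rho / n%:R) F.
Proof.
move=> p01 F0 F1; apply: ler_sum => w _; have w0 := config_weight_ge0 p01 w.
by case: asboolP => [/F1 h|_]; rewrite ?mulr_ge0 // ler_peMr.
Qed.

(** By contraposition [E] forces tr X^K > mu^K or a large degree deviation at some vertex. [F] sums
    nonnegative majorants of these failures; the trace bound is taken at tau = 1 / sqrt rho. *)
Lemma ER_prob_bad (rho mu delta c q : R) (s : nat) (E : config n -> Prop) :
  0 < rho < n%:R -> 0 < mu -> 0 <= delta <= 2 -> 0 <= q ->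
  let K := (2 ^ s.+1)%N in let r := Num.sqrt rho in let p := rho / n%:R in
  (4 * K + 4)%:R <= q ^+ 2 ->
  r + p / r * (n%:R + 4 * K%:R) + 5 * K%:R / r + p / rho * q * (2 * n%:R + 12 * K%:R * q) <= c ->
  (forall w, (forall x, dot (centered p w *m x) (centered p w *m x) <= mu ^+ 2 * dot x x) ->
     (forall i, `|degree_dev p w i| <= delta * rho) -> ~ E w) ->
  ER_prob n rho E <=
    n%:R * (c / mu) ^+ K + 2 * (n%:R * expR (- (delta ^+ 2 * rho / 8))).
Proof.
move=> /andP[r0 rn] mu0 /andP[d0 d2] q0 K r p qK hc hE.
have n0 : 0 < n%:R :> R by exact: lt_trans rn.
have p01 : 0 <= p <= 1.
  by apply/andP; split; [rewrite divr_ge0 // ltW|rewrite ler_pdivrMr // mul1r ltW].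
have pn : n%:R * p = rho by rewrite mulrC divfK // gt_eqF.
have rr0 : 0 < r by rewrite sqrtr_gt0.
have rE : r ^+ 2 = rho by rewrite sqr_sqrtr // ltW.
(* The minimiser of 2 rho th^2 - th delta rho, with minimum -(delta^2 rho / 8); [delta <= 2] gives
   th <= 1/2. *)
pose th := delta / 4.
pose F (w : config n) := \tr (centered p w ^+ K) * (mu ^+ K)^-1 +
  \sum_i (expR (th * degree_dev p w i) * expR (- (th * (delta * rho))) +
          expR (- th * degree_dev p w i) * expR (- (th * (delta * rho)))).
have muK : 0 < mu ^+ K by rewrite exprn_gt0.
have tr0 (w : config n) : 0 <= \tr (centered p w ^+ K) by apply: trace_pow_ge0; exact: centered_sym.
have S0 (w : config n) : 0 <= \sum_i (expR (th * degree_dev p w i) * expR (- (th * (delta * rho))) +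
          expR (- th * degree_dev p w i) * expR (- (th * (delta * rho)))).
  by apply: sumr_ge0 => i _; rewrite addr_ge0 // mulr_ge0 ?expR_ge0.
have T0 (w : config n) : 0 <= \tr (centered p w ^+ K) * (mu ^+ K)^-1.
  by rewrite mulr_ge0 // invr_ge0 ltW.
have F1 w : E w -> 1 <= F w.
  move=> Ew; rewrite leNgt; apply/negP => Fw; apply: (hE w) => // [x|i].
    apply: (@dot_mulmx_le _ _ s) => //; [exact: centered_sym|exact: ltW|].
    rewrite -/K -[leRHS]mul1r -ler_pdivrMr //; apply: le_trans (ltW Fw).
    by rewrite /F lerDl.
  rewrite leNgt; apply/negP => di; move: Fw; apply/negP; rewrite -leNgt.
  apply: (@le_trans _ _ (expR (th * degree_dev p w i) * expR (- (th * (delta * rho))) +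
          expR (- th * degree_dev p w i) * expR (- (th * (delta * rho))))); last first.
    rewrite /F (bigD1 i) //= addrCA lerDl addr_ge0 //.
    by apply: sumr_ge0 => j _; rewrite addr_ge0 // mulr_ge0 ?expR_ge0.
  have th0 : 0 <= th by rewrite divr_ge0.
  have e1 (y : R) : delta * rho <= y -> 1 <= expR (th * y) * expR (- (th * (delta * rho))).
    move=> hy; rewrite -expRD -expR0 ler_expR -mulrBr mulr_ge0 // subr_ge0 //.
  move: di; rewrite lter_normr => /orP[di|di].
    by rewrite ler_wpDr ?mulr_ge0 ?expR_ge0 // e1 // ltW.
  by rewrite ler_wpDl ?mulr_ge0 ?expR_ge0 // mulNr -mulrN e1 // ltW.
apply: le_trans (ER_prob_le_expect p01 _ F1) _; first by move=> w; rewrite addr_ge0.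
rewrite /F expectD expectZ -/p; apply: lerD.
  rewrite exprMn exprVn mulrA; apply: ler_wpM2r; first by rewrite invr_ge0 ltW.
  have rV0 : 0 < r^-1 by rewrite invr_gt0.
  apply: (expect_trace_le p01 rV0 q0 qK); apply: le_trans hc.
  rewrite invrK exprVn rE (mulrC r^-1); lra.
rewrite expect_sum; apply: (@le_trans _ _ (\sum_(i < n) 2 * expR (- (delta ^+ 2 * rho / 8)))); last first.
  rewrite sumr_const card_ord -[leLHS]mulr_natl.
  by rewrite le_eqVlt; apply/orP; left; apply/eqP; ring.
apply: ler_sum => i _; rewrite expectD !expectZ.
have t1 : th <= 2^-1 by rewrite /th; lra.
have t2 : - th <= 2^-1 by rewrite /th; lra.
have e1 := expect_degree_dev p01 i t1; have e2 := expect_degree_dev p01 i t2.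
rewrite pn sqrrN in e2; rewrite pn in e1.
have -> : - (delta ^+ 2 * rho / 8) = 2 * rho * th ^+ 2 - th * (delta * rho).
  by rewrite /th; field.
rewrite expRD mulr_natl mulr2n; apply: lerD; rewrite ler_wpM2r ?expR_ge0 //.
Qed.

End ProbabilityBound.

(** * Auxiliary estimates for the choice of parameters *)

Lemma pow2_between (R : realType) (y : R) : 2 <= y ->
  exists s, y <= (2 ^ s.+1)%:R <= 2 * y.
Proof.
move=> y2; have ex : exists s, y <= (2 ^ s.+1)%:R.
  exists (Num.bound y); have y0 : 0 <= y by lra.
  apply: le_trans (ltW (archi_boundP y0)) _; rewrite ler_nat.
  by apply: leq_trans (ltnW (ltn_expl _ (ltnSn 1))) _; rewrite leq_exp2l.
(* Minimality of the exponent bounds the power by 2 y. *)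
case: (ex_minnP ex) => -[|s] h1 h2.
  by exists 0%N; rewrite h1 expn1; lra.
exists s.+1; rewrite h1 /= expnS natrM ler_pM2l // leNgt; apply/negP => h3.
by have := h2 s (ltW h3); rewrite ltnn.
Qed.

Lemma ln_cube_le (R : realType) (y : R) : 1 <= y -> ln y ^+ 3 <= 27 * y.
Proof.
move=> y1; have l0 : 0 <= ln y by exact: ln_ge0.
have e : ln y / 3 <= expR (ln y / 3) by have := expR_ge1Dx (ln y / 3); lra.
have e3 : (ln y / 3) ^+ 3 <= expR (ln y / 3) ^+ 3.
  by rewrite ler_pXn2r ?nnegrE ?expR_ge0 // divr_ge0.
have : expR (ln y / 3) ^+ 3 = y.
  rewrite -expRM_natl mulrC divfK // lnK // posrE; lra.
move=> E; rewrite E in e3.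
have -> : ln y ^+ 3 = 27 * (ln y / 3) ^+ 3 by field.
by rewrite ler_pM2l.
Qed.

(** Since 3/k^2 <= 3/(k-1) - 3/k, the partial sum plus 3/(m-1) does not increase from [N] on. *)
Lemma nneseries_lt_pinfty (R : realType) (P : nat -> R) (N : nat) : (2 <= N)%N ->
  (forall n, (2 <= n)%N -> 0 <= P n) ->
  (forall n, (N <= n)%N -> P n <= 3 / n%:R ^+ 2) ->
  (\sum_(2 <= n <oo) (P n)%:E < +oo)%E.
Proof.
move=> N2 P0 PN.
pose M := \sum_(2 <= k < N) P k + 3 / (N%:R - 1).
have key m : (N <= m)%N -> \sum_(2 <= k < m) P k + 3 / (m%:R - 1) <= M.
  move=> /subnK <-; elim: (m - N)%N => [|d IH]; first by rewrite add0n.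
  apply: le_trans IH; rewrite addSn; set k := (d + N)%N.
  have k2 : (2 <= k)%N by rewrite (leq_trans N2) // leq_addl.
  rewrite big_nat_recr //= -addrA lerD2l.
  have k1 : 1 < k%:R :> R by rewrite ltr1n.
  have Pk : P k <= 3 / k%:R ^+ 2 by apply: PN; rewrite leq_addl.
  rewrite -[k.+1]addn1 natrD addrK; apply: le_trans (lerD Pk (lexx _)) _.
  have -> : 3 / k%:R ^+ 2 + 3 / k%:R = 3 * (1 + k%:R) / k%:R ^+ 2 :> R.
    by field; rewrite gt_eqF //; lra.
  rewrite ler_pdivrMr ?exprn_gt0 //; last by lra.
  rewrite mulrAC ler_pdivlMr ?subr_gt0 // expr2; lra.
apply: (@le_lt_trans _ _ M%:E); last exact: ltry.
apply: lime_le; first by apply: is_cvg_nneseries => n n2 _; rewrite lee_fin P0.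
exists N => // m /= Nm; rewrite sumEFin lee_fin; apply: le_trans (key m Nm).
by rewrite lerDl divr_ge0 // subr_ge0 ler1n; apply: leq_trans Nm; exact: ltnW.
Qed.

(** Here x = chi_n^(1/8), l = ln n, r = sqrt rho, N = n, k is the walk length and q = sqrt (8 k).
    The main terms give 2 r; the others are 4 k r / N, 5 k / r, 2 q and 96 k^2 / N, all small
    against r / x^2. *)
Lemma growth_rate_le (R : realFieldType) (x l r k q N : R) :
  10 ^+ 5 <= x -> 0 <= l -> l ^+ 3 <= 27 * N -> 0 < r -> r ^+ 2 = x ^+ 8 * l ->
  r ^+ 2 < N -> x ^+ 4 <= r -> 0 <= k -> k <= 2 * (72 * x ^+ 2 * l) ->
  0 <= q -> q ^+ 2 = 8 * k ->
  r + r ^+ 2 / N / r * (N + 4 * k) + 5 * k / r + r ^+ 2 / N / r ^+ 2 * q * (2 * N + 12 * k * q)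
    <= (2 + x ^- 2 / 8) * r.
Proof.
move=> x5 l0 l3 r0 rE rN x4r k0' ku q0 qE.
have x0 : 0 < x by apply: lt_le_trans x5; rewrite exprn_gt0.
have n0 : 0 < N by exact: le_lt_trans (sqr_ge0 r) rN.
have rn0 : r != 0 by rewrite gt_eqF.
rewrite -[x ^- 2]exprVn; set j := x^-1.
have xj : x * j = 1 by rewrite divff // gt_eqF.
have j0 : 0 < j by rewrite invr_gt0.
have j5 : 10 ^+ 5 * j <= 1 by have := ler_wpM2r (ltW j0) x5; rewrite xj.
have t5 : 0 <= 10 ^+ 5 :> R by rewrite exprn_ge0.
have x2 : 10 ^+ 10 <= x ^+ 2 by have := ler_pM t5 t5 x5 x5; rewrite -exprD -expr2.
have xl : x ^+ 2 * l = j ^+ 6 * r ^+ 2.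
  rewrite rE; have -> : j ^+ 6 * (x ^+ 8 * l) = (x * j) ^+ 6 * (x ^+ 2 * l) by ring.
  by rewrite xj expr1n mul1r.
have j2 : 0 < j ^+ 2 by rewrite exprn_gt0.
have jr4 : 10 ^+ 10 * j ^+ 4 <= j ^+ 2.
  have -> : 10 ^+ 10 * j ^+ 4 = (10 ^+ 5 * j ^+ 2) ^+ 2 by ring.
  have a0 : 0 <= 10 ^+ 5 * j ^+ 2 by rewrite mulr_ge0 // ltW.
  rewrite ler_pXn2r ?nnegrE ?(ltW j0) //.
  by have := ler_wpM2r (ltW j0) j5; rewrite mul1r expr2 mulrA.
have nn0 : N != 0 :> R by rewrite gt_eqF.
have -> : r + r ^+ 2 / N / r * (N + 4 * k) + 5 * k / r +
   r ^+ 2 / N / r ^+ 2 * q * (2 * N + 12 * k * q) =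
   2 * r + 4 * k * (r / N) + 5 * (k / r) + 2 * q + 12 * k * (8 * k) / N.
  by rewrite -qE; field; rewrite rn0 nn0.
have g1 : r / N <= r^-1.
  by rewrite ler_pdivrMr // mulrC ler_pdivlMr // -expr2 ltW.
have g1' := ler_wpM2l (mulr_ge0 (ler0n R 4) k0') g1.
have g2 : k / r <= 144 * j ^+ 6 * r.
  by rewrite ler_pdivrMr // -[_ * r * r]mulrA -expr2 -mulrA -xl; lra.
have j6 : 10 ^+ 10 * j ^+ 6 <= j ^+ 2.
  apply: le_trans jr4; rewrite ler_wpM2l ?exprn_ge0 // ler_wiXn2l // ?(ltW j0) //; lra.
have g2' := ler_wpM2r (ltW r0) j6.
have h3 : q <= 34 * j ^+ 3 * r.
  rewrite -(@ler_pXn2r _ 2) ?nnegrE ?mulr_ge0 ?exprn_ge0 ?(ltW r0) ?(ltW j0) //.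
  rewrite qE; have -> : (34 * j ^+ 3 * r) ^+ 2 = 1156 * (j ^+ 6 * r ^+ 2) by ring.
  by rewrite -xl; have := mulr_ge0 (ltW (exprn_gt0 2 x0)) l0; lra.
have j3 : 10 ^+ 5 * j ^+ 3 <= j ^+ 2.
  by have := ler_wpM2r (ltW j2) j5; rewrite mul1r [j ^+ 3]exprS mulrA.
have h3' := ler_wpM2r (ltW r0) j3.
(* From (x^4 l^2)^2 = r^2 l^3 <= 27 N^2. Hence k^2 / N is bounded, which is small against r / x^2 >=
   10^10. *)
have h4 : x ^+ 4 * l ^+ 2 <= 6 * N.
  rewrite -(@ler_pXn2r _ 2) ?nnegrE ?mulr_ge0 ?exprn_ge0 ?(ltW x0) ?(ltW n0) //.
    have := ler_pM (sqr_ge0 r) (exprn_ge0 3 l0) (ltW rN) l3.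
  have -> : r ^+ 2 * l ^+ 3 = (x ^+ 4 * l ^+ 2) ^+ 2 by rewrite rE; ring.
  have := mulr_ge0 (ltW n0) (ltW n0); rewrite exprMn !expr2; lra.
have h5 : k ^+ 2 <= 144 ^+ 2 * (x ^+ 4 * l ^+ 2).
  have ku' : k <= 144 * (x ^+ 2 * l) by lra.
  by have := ler_pM k0' k0' ku' ku'; rewrite -expr2; lra.
have h6 : 12 * k * (8 * k) / N <= (96 * 6 * 144 ^+ 2).
  by rewrite ler_pdivrMr //; move: h5; rewrite expr2; lra.
have h7 : 10 ^+ 10 <= j ^+ 2 * r.
  apply: le_trans x2 _.
  have -> : x ^+ 2 = j ^+ 2 * x ^+ 4.
    have -> : j ^+ 2 * x ^+ 4 = (x * j) ^+ 2 * x ^+ 2 by ring.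
    by rewrite xj expr1n mul1r.
  by rewrite ler_wpM2l // ltW.
lra.
Qed.

(** * The probability estimate for a single graph size *)

Section Asymptotics.
Variables (R : realType) (n : nat) (x kappa : R).

Lemma ln_ge1 : (4 <= n)%N -> 1 <= ln n%:R :> R.
Proof.
move=> n4; have n4' : 4 <= n%:R :> R by rewrite ler_nat.
rewrite -[leLHS]expRK ler_ln ?posrE ?expR_gt0 //; last by lra.
apply: le_trans n4'.
have -> : 1 = 2^-1 + 2^-1 :> R by field.
have h := @expR_le R 2^-1 (lexx _); have h0 := expR_ge0 (2^-1 : R).
rewrite expRD; have : expR (2^-1 : R) <= 2 by move: h; rewrite expr2; lra.
by move=> h2; have := ler_pM h0 h0 h2 h2; lra.
Qed.

Lemma ER_prob_Phi_le (D : R -> R -> R[i] -> Prop) :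
  let rho := x ^+ 8 * ln n%:R in
  let eps' := 1 / (Num.sqrt rho * (1 - kappa)) in
  (4 <= n)%N -> rho < n%:R -> 0 < kappa < 1 -> 10 ^+ 5 / kappa <= x ->
  (forall v, D (2 / x) eps' v -> dom1 (2 / x) eps' v \/ dom2 (2 / x) eps' v) ->
  ER_prob n rho (Phi D n rho (2 / x) eps') <= 3 / n%:R ^+ 2.
Proof.
move=> rho eps' n4 rn /andP[k0 k1] xk hD.
have l1 := ln_ge1 n4; set l := ln n%:R in l1 rho eps' rn hD *.
have kV : 1 < kappa^-1 by rewrite invf_gt1.
have x5 : 10 ^+ 5 <= x.
  by apply: le_trans xk; rewrite ler_peMr // ?exprn_ge0 // ltW.
have x0 : 0 < x by lra.
pose j := x^-1; have xj : x * j = 1 by rewrite divff // gt_eqF.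
have j0 : 0 < j by rewrite invr_gt0.
have j5 : 10 ^+ 5 * j <= 1 by have := ler_wpM2r (ltW j0) x5; rewrite xj.
have j2 : 0 < j ^+ 2 by rewrite exprn_gt0.
have j25 : 10 ^+ 5 * j ^+ 2 <= j.
  by have := ler_wpM2r (ltW j0) j5; rewrite mul1r expr2 mulrA.
(* The budget eps^2 / 4 = j^2 of [zeta_inv_neq0] is shared: j^2 / 4 for the degree deviations, j^2 /
   4 for the excess of [mu] over 2 r, at most j^2 / 8 each for 2 / rho and the constants. *)
pose eta0 := j ^+ 2 / 4.
have eta0_ge0 : 0 <= eta0 by rewrite divr_ge0 // ltW.
have eta0_le1 : eta0 <= 1 by rewrite /eta0; lra.
have n0 : 0 < n%:R :> R by rewrite ltr0n; apply: leq_trans n4.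
have x8 : 0 < x ^+ 8 by rewrite exprn_gt0.
have rho0 : 0 < rho by rewrite mulr_gt0 //; lra.
have l0 : 0 <= l by lra.
pose r := Num.sqrt rho.
have r0 : 0 < r by rewrite sqrtr_gt0.
have rE : r ^+ 2 = rho by rewrite sqr_sqrtr // ltW.
have rn0 : r != 0 by rewrite gt_eqF.
have x4r : x ^+ 4 <= r.
  rewrite -(@ler_pXn2r _ 2) ?nnegrE ?exprn_ge0 ?(ltW x0) ?(ltW r0) // rE -exprM.
  by rewrite ler_peMr // ltW.
have ir : 1 <= j ^+ 4 * r.
  have -> : 1 = j ^+ 4 * x ^+ 4 by rewrite -exprMn mulrC xj expr1n.
  by rewrite ler_wpM2l // exprn_ge0 // ltW.
have t5 : 0 <= 10 ^+ 5 :> R by rewrite exprn_ge0.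
have x2 : 10 ^+ 10 <= x ^+ 2 by have := ler_pM t5 t5 x5 x5; rewrite -exprD -expr2.
have y2 : 2 <= 72 * x ^+ 2 * l.
  by have := ler_wpM2l (sqr_ge0 x) l1; rewrite mulr1; lra.
(* The walk length [K] is a power of two; 72 makes eta0 K / 6 >= 3 ln n. *)
have [s] := pow2_between y2; set K := (2 ^ s.+1)%N; set k : R := K%:R => /andP[kl ku].
have k1' : 1 <= k by clear -kl y2; lra.
have k0' : 0 <= k by clear -k1'; lra.
pose q := Num.sqrt (8 * k).
have qE : q ^+ 2 = 8 * k by rewrite sqr_sqrtr // mulr_ge0.
have q0 : 0 <= q by exact: sqrtr_ge0.
(* The growth rate [c] lies halfway between 2 r and the threshold [mu]; the gap makes (c / mu)^K
   decay. *)
pose mu := (2 + eta0) * r; pose c := (2 + eta0 / 2) * r.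
pose eta := eta0 + (1 + 36 / kappa ^+ 2) / r.
have jr4 : 10 ^+ 10 * j ^+ 4 <= j ^+ 2.
  have -> : 10 ^+ 10 * j ^+ 4 = (10 ^+ 5 * j ^+ 2) ^+ 2 by ring.
  have a0 : 0 <= 10 ^+ 5 * j ^+ 2 by rewrite mulr_ge0 // ltW.
  by rewrite ler_pXn2r ?nnegrE // ltW.
have rV : r^-1 <= j ^+ 4 by rewrite -[leLHS]mul1r ler_pdivrMr.
have mu0 : 0 < mu by rewrite mulr_gt0 // addr_gt0 // divr_gt0.
have kV0 : 0 <= kappa^-1 by clear -kV; lra.
have x1 : 1 <= x by clear -x5; lra.
have h0 : x <= r by apply: le_trans x4r; rewrite exprS ler_peMr ?exprn_ege1 // ltW.
have h1 : 1 <= r by exact: le_trans h0.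
have kr : 4 <= kappa * rho.
  have h2 : x <= rho by apply: le_trans h0 _; rewrite -rE expr2 ler_peMl // ltW.
  have := ler_wpM2l (ltW k0) (le_trans xk h2); rewrite mulrC divfK ?gt_eqF //; clear; lra.
have kk : 10 ^+ 10 * kappa ^- 2 <= x ^+ 2.
  have -> : 10 ^+ 10 * kappa ^- 2 = (10 ^+ 5 / kappa) ^+ 2 by rewrite exprMn exprVn -exprM.
  by rewrite ler_pXn2r ?nnegrE ?mulr_ge0 // ltW.
have eta_small : (1 + 36 / kappa ^+ 2) / r <= j ^+ 2 / 8.
  have e0 : 0 <= 1 + 36 / kappa ^+ 2 by rewrite addr_ge0 // divr_ge0 // sqr_ge0.
  apply: (@le_trans _ _ ((1 + 36 / kappa ^+ 2) * j ^+ 4)); first by rewrite ler_wpM2l.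
  have := ler_wpM2r (exprn_ge0 4 (ltW j0)) kk.
  have -> : x ^+ 2 * j ^+ 4 = (x * j) ^+ 2 * j ^+ 2 by ring.
  by rewrite xj expr1n mul1r; clear -jr4 j2; lra.
have rhoV : 2 / rho <= j ^+ 2 / 8.
  have h : rho^-1 <= j ^+ 4.
    rewrite -rE -exprVn expr2; have rV0 : 0 <= r^-1 by rewrite invr_ge0 ltW.
    by apply: le_trans rV; rewrite ler_piMl // invf_le1.
  by clear -h jr4 j2; lra.
have eps_E : (2 / x) ^+ 2 / 4 = j ^+ 2 by rewrite /j; field; rewrite gt_eqF.
have hbad w : (forall z, dot (centered (rho / n%:R) w *m z) (centered (rho / n%:R) w *m z) <= mu ^+ 2 * dot z z) ->
     (forall i, `|degree_dev (rho / n%:R) w i| <= eta0 * rho) -> ~ Phi D n rho (2 / x) eps' w.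
  move=> hC hdev [v [Dv zv]].
  have hk : 0 < kappa < 1 by rewrite k0.
  have hr : 0 < rho < n%:R by rewrite rho0.
  have he : 0 < 2 / x <= 2^-1.
    by apply/andP; split; [rewrite divr_gt0|rewrite ler_pdivrMr //; clear -x5; lra].
  have hm9 : mu ^+ 2 <= 9 * rho.
    rewrite exprMn rE ler_wpM2r ?(ltW rho0) //.
    have -> : 9 = 3 ^+ 2 :> R by ring.
    rewrite ler_pXn2r ?nnegrE ?addr_ge0 //.
    by clear -eta0_le1; lra.
  have he0 : 0 <= eta.
    have e0 : 0 <= 1 + 36 / kappa ^+ 2 by rewrite addr_ge0 // divr_ge0 // sqr_ge0.
    by rewrite /eta addr_ge0 // divr_ge0 // ltW.
  have hs : eta0 + 2 / rho + eta <= (2 / x) ^+ 2 / 4.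
    by rewrite eps_E /eta /eta0; clear -eta_small rhoV j2; lra.
  have hmu : mu + 1 + 36 / kappa ^+ 2 <= (2 + eta) * Num.sqrt rho.
    rewrite -/r le_eqVlt; apply/orP; left; apply/eqP; rewrite /mu /eta.
    by field; rewrite rn0 gt_eqF.
  have := zeta_inv_neq0 hr hk kr (ltW mu0) hm9 he eta0_ge0 he0 hs hmu hC hdev (hD v Dv).
  by rewrite zv eqxx.
have hc : r + rho / n%:R / r * (n%:R + 4 * k) + 5 * k / r +
     rho / n%:R / rho * q * (2 * n%:R + 12 * k * q) <= c.
  have l3 : l ^+ 3 <= 27 * n%:R by apply: ln_cube_le; rewrite ler1n; apply: leq_trans n4.
  have rn' : r ^+ 2 < n%:R by rewrite rE.
  have := growth_rate_le x5 l0 l3 r0 rE rn' x4r k0' ku q0 qE.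
  rewrite -[x ^- 2]exprVn -/j rE => /le_trans; apply.
  by rewrite /c /eta0 le_eqVlt; apply/orP; left; apply/eqP; field.
have hrn : 0 < rho < n%:R by rewrite rho0.
have hd : 0 <= eta0 <= 2 by rewrite eta0_ge0 (le_trans eta0_le1) // ler1n.
have hq : (4 * K + 4)%:R <= q ^+ 2.
  by rewrite qE natrD natrM -/k; clear -k1'; lra.
apply: le_trans (ER_prob_bad hrn mu0 hd q0 hq hc hbad) _.
have expl : expR (- (3 * l)) = (n%:R ^+ 3)^-1.
  by rewrite expRN expRM_natl lnK // posrE.
have hK : (c / mu) ^+ K <= (n%:R ^+ 3)^-1.
  have cm : c / mu <= expR (- (eta0 / 6)).
    apply: le_trans (expR_ge1Dx _); rewrite ler_pdivrMr // /c /mu mulrA ler_wpM2r ?(ltW r0) //.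
    have e0 : 0 <= eta0 * (1 - eta0) by rewrite mulr_ge0 // subr_ge0.
    by clear -e0; lra.
  apply: (@le_trans _ _ (expR (- (eta0 / 6)) ^+ K)).
    apply: lerXn2r; rewrite ?nnegrE ?expR_ge0 //.
    by rewrite divr_ge0 ?(ltW mu0) // mulr_ge0 ?(ltW r0) // addr_ge0 // divr_ge0.
  rewrite -expRM_natl -expl ler_expR -/k /eta0.
  have := ler_wpM2l (ltW j2) kl.
  have -> : j ^+ 2 * (72 * x ^+ 2 * l) = 72 * (x * j) ^+ 2 * l by ring.
  by rewrite xj expr1n; clear; lra.
have hE : expR (- (eta0 ^+ 2 * rho / 8)) <= (n%:R ^+ 3)^-1.
  rewrite -expl ler_expR lerN2.
  have -> : eta0 ^+ 2 * rho / 8 = (x * j) ^+ 4 * (x ^+ 4 * l) / 128.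
    by rewrite /eta0 /rho; field.
  rewrite xj expr1n mul1r.
  have x4 : 10 ^+ 10 <= x ^+ 4.
    apply: le_trans x2 _; rewrite ler_weXn2l //; lra.
  by have := ler_wpM2r l0 x4; clear -l0; lra.
have nV : 3 / n%:R ^+ 2 = n%:R * (n%:R ^+ 3)^-1 + 2 * (n%:R * (n%:R ^+ 3)^-1) :> R.
  by field; rewrite gt_eqF.
rewrite nV; apply: lerD; first by rewrite ler_wpM2l // ltW.
by rewrite ler_wpM2l // ler_wpM2l // ltW.
Qed.

End Asymptotics.

(** * Summation over all graph sizes *)

Unset Implicit Arguments.

Theorem theorem2p1 (R : realType) (chi : nat -> R) (kappa : R)
  (chi_pos : forall n : nat, (2 <= n)%N -> 0 < chi n)
  (chi_inf : chi n @[n --> \oo] --> +oo)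
  (rho_bounds : forall n : nat, (2 <= n)%N ->
     0 < chi n * ln n%:R /\ chi n * ln n%:R < n%:R)
  (kappa_pos : 0 < kappa) (kappa_lt1 : kappa < 1) :
  let rho := fun n : nat => chi n * ln n%:R in
  let eps := fun n : nat => 2 / chi n `^ (8^-1) in
  let eps' := fun n : nat => 1 / (Num.sqrt (rho n) * (1 - kappa)) in
  (\sum_(2 <= n <oo)
     (ER_prob n (rho n) (Phi (@dom1 R) n (rho n) (eps n) (eps' n)))%:E < +oo)%E
  /\
  (\sum_(2 <= n <oo)
     (ER_prob n (rho n) (Phi (@dom2 R) n (rho n) (eps n) (eps' n)))%:E < +oo)%E.
Proof.
move=> rho eps eps'.
(* From [N] on, x = chi_n^(1/8) is at least 10^5 / kappa, as [ER_prob_Phi_le] asks; only finitely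
   many terms remain. *)
have [N _ hN] : \forall n \near \oo, (10 ^+ 5 / kappa) ^+ 8 <= chi n.
  by move/cvgryPge: chi_inf; apply.
have p01 n : (2 <= n)%N -> 0 <= rho n / n%:R <= 1.
  move=> n2; have [h1 h2] := rho_bounds n n2.
  by apply/andP; split; [rewrite divr_ge0 // ltW|rewrite ler_pdivrMr ?mul1r ?ltW // (lt_trans h1)].
have main (D : R -> R -> R[i] -> Prop) :
    (forall a b v, D a b v -> dom1 a b v \/ dom2 a b v) ->
    (\sum_(2 <= n <oo) (ER_prob n (rho n) (Phi D n (rho n) (eps n) (eps' n)))%:E < +oo)%E.
  move=> hD; apply: (@nneseries_lt_pinfty _ _ (maxn N 4)).
  - by rewrite (leq_trans _ (leq_maxr N 4)).
  - by move=> n n2; apply: ER_prob_ge0; exact: p01.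
  move=> n; rewrite geq_max => /andP[nN n4].
  have n2 : (2 <= n)%N by exact: leq_trans n4.
  have c0 := chi_pos n n2; have [_ rn] := rho_bounds n n2.
  pose x := chi n `^ (8^-1).
  have xE : x ^+ 8 = chi n.
    by rewrite -powR_mulrn ?powR_ge0 // -powRrM mulVf // powRr1 // ltW.
  have xk : 10 ^+ 5 / kappa <= x.
    rewrite -(@ler_pXn2r _ 8) ?nnegrE ?powR_ge0 //; first by rewrite xE; exact: hN.
    by rewrite divr_ge0 ?exprn_ge0 // ltW.
  have := @ER_prob_Phi_le R n x kappa D; rewrite xE; apply => //; last by move=> v; exact: hD.
  by rewrite kappa_pos.
by split; apply: main => a b v; [left|right].
Qed.
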